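(* For a compact Riemannian $n$-manifold $(M,g)$, one has $\mathrm{Ein}(g)=n$ if and only if $g$ is an Einstein metric with positive scalar curvature.
   Context: Manifolds are smooth, and compact manifolds are without boundary. $\mathrm{Ric}$ and $\mathrm{Scal}$ denote the Ricci tensor and scalar curvature of $g$. For real $k$, $\mathrm{Ein}_k(g):=\mathrm{Scal}\cdot g-k\,\mathrm{Ric}$, and $\mathrm{Ein}_k>0$ means positive definite at every point. For a metric $g$ on an $n$-manifold, $\mathrm{Ein}(g):=\sup\{k\in(0,n):\mathrm{Ein}_k(g)>0\}$ if $\mathrm{Scal}(g)$ is positive everywhere, and $\mathrm{Ein}(g):=0$ if the scalar curvature of $g$ is not positive.
   Formalization: Einstein means Ric = λg with λ constant on each connected component, and in dimension 2 λ may be any function; with one constant λ the claim fails for non-round positively curved spheres and for disjoint spheres of different radii. The dimension is at least 1. *)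

(* Defs.v *)
From HB Require Import structures.
From mathcomp Require Import all_boot all_order all_algebra.
From mathcomp Require Import all_classical all_reals all_analysis.

Set Implicit Arguments.
Unset Strict Implicit.
Unset Printing Implicit Defensive.

Import Order.TTheory GRing.Theory Num.Theory.
Import numFieldNormedType.Exports.

Local Open Scope classical_set_scope.
Local Open Scope ring_scope.

(* C^oo on U, intended for U open: every iterated directional derivative
   D_{v_1} ... D_{v_m} f (including f itself, m = 0) is Frechet differentiable
   at every point of U. *)
Definition iter_derive (R : realType) (n : nat) (W : normedModType R)
    (s : seq 'rV[R]_n) (f : 'rV[R]_n -> W) : 'rV[R]_n -> W :=
  foldr (fun v h => (fun x => 'D_v h x)) f s.

Definition smooth_on (R : realType) (n : nat) (W : normedModType R)
    (U : set 'rV[R]_n) (f : 'rV[R]_n -> W) : Prop :=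
  forall (s : seq 'rV[R]_n) (x : 'rV[R]_n),
    U x -> differentiable (iter_derive s f) x.

(* A homeomorphism from an open set of M onto an open set of R^n. The maps are
   total functions whose values outside [chart_dom], resp. its image, are
   irrelevant. *)
Record chart (R : realType) (n : nat) (M : topologicalType) := Chart {
  chart_dom : set M;
  chart_map :> M -> 'rV[R]_n;
  chart_inv : 'rV[R]_n -> M;
  chart_dom_open : open chart_dom;
  chart_img_open : open (chart_map @` chart_dom);
  chart_mapK : forall p, chart_dom p -> chart_inv (chart_map p) = p;
  chart_map_continuous : {within chart_dom, continuous chart_map};
  chart_inv_continuous :
    {within chart_map @` chart_dom, continuous chart_inv}
}.

Definition chart_img (R : realType) (n : nat) (M : topologicalType)
  (c : chart R n M) : set 'rV[R]_n := c @` chart_dom c.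

Definition overlap (R : realType) (n : nat) (M : topologicalType)
  (c d : chart R n M) : set 'rV[R]_n := c @` (chart_dom c `&` chart_dom d).

Definition transition (R : realType) (n : nat) (M : topologicalType)
  (c d : chart R n M) : 'rV[R]_n -> 'rV[R]_n := d \o chart_inv c.

(* The smooth structure is given by an atlas, not required to be maximal. *)
Record smoothManifold (R : realType) (n : nat) := SmoothManifold {
  carrier :> topologicalType;
  manifold_hausdorff : hausdorff_space carrier;
  manifold_second_countable : @second_countable carrier;
  atlas : set (chart R n carrier);
  atlas_cover : forall p : carrier, exists2 c, atlas c & chart_dom c p;
  atlas_smooth : forall c d, atlas c -> atlas d ->
    smooth_on (overlap c d) (transition c d)
}.

Definition posdef (R : realType) (n : nat) (A : 'M[R]_n) : Prop :=
  forall v : 'rV[R]_n, v != 0 -> 0 < (v *m A *m v^T) 0 0.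

(* [metric c x] is the Gram matrix, at the point of coordinates x in the chart
   c, of the coordinate frame of c. Tangent vectors are row vectors and the
   differential of a map f at x is v |-> v *m 'J f x, hence the form taken by
   the transformation law of (0,2)-tensors. *)
Record riemannianMetric (R : realType) (n : nat) (M : smoothManifold R n) :=
  RiemannianMetric {
  metric :> chart R n M -> 'rV[R]_n -> 'M[R]_n;
  metric_smooth : forall c, atlas c -> smooth_on (chart_img c) (metric c);
  metric_sym : forall c x, atlas c -> chart_img c x ->
    (metric c x)^T = metric c x;
  metric_posdef : forall c x, atlas c -> chart_img c x -> posdef (metric c x);
  metric_transition : forall c d x, atlas c -> atlas d -> overlap c d x ->
    metric c x = 'J (transition c d) x *m metric d (transition c d x)
                   *m ('J (transition c d) x)^T
}.

Section local_curvature.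
Context (R : realType) (n : nat).
Implicit Types (G : 'rV[R]_n -> 'M[R]_n) (x : 'rV[R]_n) (i j k l m : 'I_n).

Definition partial i (f : 'rV[R]_n -> R) : 'rV[R]_n -> R :=
  fun x => 'D_(delta_mx 0 i) f x.

(* Gamma^l_{ij} of the Levi-Civita connection:
   nabla_{e_i} e_j = sum_l Gamma^l_{ij} e_l *)
Definition christoffel G l i j : 'rV[R]_n -> R := fun x =>
  2^-1 * \sum_(m < n) invmx (G x) l m *
    (partial i (fun y => G y j m) x + partial j (fun y => G y i m) x
     - partial m (fun y => G y i j) x).

(* R^l_{kij}, where R(e_i, e_j) e_k = sum_l R^l_{kij} e_l and
   R(X, Y) = [nabla_X, nabla_Y] - nabla_{[X, Y]} *)
Definition riemann G l k i j : 'rV[R]_n -> R := fun x =>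
  partial i (christoffel G l j k) x - partial j (christoffel G l i k) x
  + \sum_(m < n) (christoffel G l i m x * christoffel G m j k x
                  - christoffel G l j m x * christoffel G m i k x).

(* Ric(Y, Z) = tr (X |-> R(X, Y) Z), so that round spheres have Ric > 0 *)
Definition local_ricci G x : 'M[R]_n :=
  \matrix_(j, k) \sum_(i < n) riemann G i k i j x.

Definition local_scal G x : R :=
  \sum_(j < n) \sum_(k < n) invmx (G x) j k * local_ricci G x j k.

End local_curvature.

Section curvature.
Context (R : realType) (n : nat) (M : smoothManifold R n).
Implicit Types (g : riemannianMetric M) (c : chart R n M) (x : 'rV[R]_n).

(* Components, in the chart c, of the tensors Ric, Scal and Ein_k *)
Definition Ric g c x : 'M[R]_n := local_ricci (g c) x.

Definition Scal g c x : R := local_scal (g c) x.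

Definition Ein_ (k : R) g c x : 'M[R]_n :=
  Scal g c x *: g c x - k *: Ric g c x.

Definition Scal_pos g : Prop :=
  forall c x, atlas c -> chart_img c x -> 0 < Scal g c x.

Definition Ein_pos (k : R) g : Prop :=
  forall c x, atlas c -> chart_img c x -> posdef (Ein_ k g c x).

Definition Ein g : R :=
  if `[< Scal_pos g >] then
    sup [set k : R | 0 < k < n%:R /\ Ein_pos k g]
  else 0.

(* Ric = lambda g with lambda constant (on each connected component, since M is
   not assumed to be connected). In dimension 2, where Ric is always
   proportional to g, no constancy is imposed: every surface is Einstein. *)
Definition Einstein g : Prop :=
  exists lambda : M -> R,
    (forall c p, atlas c -> chart_dom c p ->
       Ric g c (c p) = lambda p *: g c (c p)) /\
    ((n != 2)%N ->
       forall p q : M, connected_component [set: M] p q ->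
         lambda p = lambda q).

End curvature.

(* Main.v *)
Require Import Defs.
From HB Require Import structures.
From mathcomp Require Import all_boot all_order all_algebra.
From mathcomp Require Import ring lra.
From mathcomp Require Import all_classical all_reals all_analysis.

Set Implicit Arguments.
Unset Strict Implicit.
Unset Printing Implicit Defensive.

Import Order.TTheory GRing.Theory Num.Theory.
Import numFieldNormedType.Exports.

Local Open Scope classical_set_scope.
Local Open Scope ring_scope.

(* If Ein(g) = n, letting k tend to n gives Scal g - n Ric >= 0; this form has
   trace zero with respect to g, so it vanishes and Ric = (Scal/n) g. The function
   Scal/n is well defined on M because the scalar curvature does not depend on the
   chart, and by Schur's lemma (contracted second Bianchi identity) it satisfies
   (n - 2) d(Scal/n) = 0. Conversely Ric = lambda g gives Ein_k = (n - k) lambda g,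
   which is positive for all k < n as soon as Scal = n lambda is.

   Locally, a connection is handled through the matrices Gam_i of nabla_{e_i}
   (row j holds the components of nabla_{e_i} e_j), so that its curvature is
   d_i Gam_j - d_j Gam_i + Gam_j Gam_i - Gam_i Gam_j and a change of frame J acts by
   Gam_i J = d_i J + J A_i. *)

(** * Calculus of partial derivatives *)

(** The g-trace of [Ein_ k] is (n - k) Scal, so strict positivity is impossible at k = n and only
    semidefiniteness passes to the supremum. The form vanishes because the inverse Gram matrix
    factors as Q Q^T: Q^T E Q is then semidefinite of trace zero, so its diagonal is zero, and so
    are its other entries. All geometric identities are equalities of matrix-valued functions on
    open sets of R^n. They rest on the product and chain rules and on the symmetry of second
    derivatives, which is proved from the mean value theorem. Curvature is of second order in g and
    Schur's lemma differentiates it once more; the finite-order classes [ck] keep track of this by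
    induction on the order. *)

Lemma near_eq_differentiable (R : realType) (V W : normedModType R)
    (F G : V -> W) (x : V) :
  (\forall y \near x, F y = G y) -> differentiable F x -> differentiable G x.
Proof.
move=> FG /diff_locallyP[dc dF].
(* The first-order expansion of F at x is also one of G; uniqueness of the differential then gives
   ['d G x]. *)
have dG : G \o shift x = cst (G x) + 'd F x +o_ 0 id.
  apply/eqaddoP => e e0; move/eqaddoP: dF => /(_ e e0) dF.
  have FG0 : \forall h \near (0 : V), F (h + x) = G (h + x).
    by move: FG; rewrite (near_shift 0) subr0.
  by apply: filterS2 FG0 dF => h FGh; rewrite !fctE /= FGh (nbhs_singleton FG).
by apply/diff_locallyP; rewrite (diff_unique dc dG).
Qed.

Section partial_calculus.
Context (R : realType) (n : nat).
Implicit Types (f g h : 'rV[R]_n -> R) (x : 'rV[R]_n) (U V : set 'rV[R]_n).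

Lemma near_eq_partial i f g x :
  (\forall y \near x, f y = g y) -> partial i f x = partial i g x.
Proof. by move=> fg; apply: near_eq_derive. Qed.

Lemma partial_cst i (a : R) x : partial i (fun=> a) x = 0.
Proof. exact: derive_cst. Qed.

Lemma partialD i f g x : differentiable f x -> differentiable g x ->
  partial i (fun y => f y + g y) x = partial i f x + partial i g x.
Proof. by move=> df dg; apply: deriveD; apply: diff_derivable. Qed.

Lemma partialN i f x : differentiable f x ->
  partial i (fun y => - f y) x = - partial i f x.
Proof. by move=> df; apply: deriveN; apply: diff_derivable. Qed.

Lemma partialM i f g x : differentiable f x -> differentiable g x ->
  partial i (fun y => f y * g y) x = partial i f x * g x + f x * partial i g x.
Proof.
move=> df dg; rewrite /partial deriveM; [|exact: diff_derivable..].
by rewrite addrC /GRing.scale/= mulrC.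
Qed.

Lemma differentiable_bigsum (I : Type) (r : seq I) (P : pred I)
    (F : I -> 'rV[R]_n -> R) x :
  (forall k, P k -> differentiable (F k) x) ->
  differentiable (fun y => \sum_(k <- r | P k) F k y) x.
Proof.
move=> dF; elim: r => [|a r IH].
  rewrite (_ : (fun y => _) = fun=> 0); first exact: differentiable_cst.
  by apply/funext => y; rewrite big_nil.
rewrite (_ : (fun y => _) = fun y => if P a then F a y + \sum_(k <- r | P k) F k y
    else \sum_(k <- r | P k) F k y); last by apply/funext => y; rewrite big_cons.
case Pa: (P a) => //.
by apply: differentiableD => //; apply: dF.
Qed.

Lemma partial_sum i (I : Type) (r : seq I) (P : pred I)
    (F : I -> 'rV[R]_n -> R) x :
  (forall k, P k -> differentiable (F k) x) ->
  partial i (fun y => \sum_(k <- r | P k) F k y) x =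
  \sum_(k <- r | P k) partial i (F k) x.
Proof.
move=> dF; elim: r => [|a r IH].
  rewrite big_nil (_ : (fun y => _) = fun=> 0); first exact: partial_cst.
  by apply/funext => y; rewrite big_nil.
rewrite (_ : (fun y => _) = fun y => if P a then F a y + \sum_(k <- r | P k) F k y
    else \sum_(k <- r | P k) F k y); last by apply/funext => y; rewrite big_cons.
rewrite big_cons; case Pa: (P a) => //.
rewrite -IH; apply: partialD; [exact: dF|exact: differentiable_bigsum].
Qed.

Lemma partialV i f x : differentiable f x -> f x != 0 ->
  partial i (fun y => (f y)^-1) x = - partial i f x * ((f x)^-1 * (f x)^-1).
Proof.
move=> df fx0; rewrite /partial deriveV//; last exact: diff_derivable.
by rewrite /GRing.scale/= !mulNr mulrC -expr2 exprVn.
Qed.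

Lemma partial_comp i (m : nat) (phi : 'rV[R]_n -> 'rV[R]_m) (h : 'rV[R]_m -> R) x :
  differentiable phi x -> differentiable h (phi x) ->
  partial i (h \o phi) x =
  \sum_a partial i (fun y => phi y 0 a) x * partial a h (phi x).
Proof.
move=> dphi dh; rewrite /partial deriveE; last exact: differentiable_comp.
rewrite diff_comp//= -(deriveE _ dphi).
have -> := row_sum_delta ('D_(delta_mx 0 i) phi x); rewrite linear_sum/=.
apply: eq_bigr => a _; rewrite linearZ/= -deriveE//; congr (_ * _).
by rewrite derive_mx ?mxE//; exact: diff_derivable.
Qed.

End partial_calculus.

(** * Functions differentiable to a finite order *)

Section ck.
Context (R : realType) (n : nat).
Implicit Types (f g : 'rV[R]_n -> R) (x : 'rV[R]_n) (U : set 'rV[R]_n).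

(* [ck k U f]: the partial derivatives of f up to order k, f included, are Frechet
   differentiable on U, so that f is k + 1 times differentiable. *)
Fixpoint ck k U f : Prop :=
  (forall x, U x -> differentiable f x) /\
  if k is k'.+1 then forall i, ck k' U (partial i f) else True.

Lemma ck_diff k U f x : ck k U f -> U x -> differentiable f x.
Proof. by case: k => [|k] [df _]; exact: df. Qed.

Lemma ckW k U f : ck k.+1 U f -> ck k U f.
Proof.
elim: k f => [|k IH] f [df pf]; split => // i.
exact/IH/pf.
Qed.

Lemma ck_sub k (U V : set 'rV[R]_n) f :
  U `<=` V -> ck k V f -> ck k U f.
Proof.
move=> UV; elim: k f => [|k IH] f [df pf]; split => //.
- by move=> x /UV; exact: df.
- by move=> x /UV; exact: df.
- by move=> i; apply/IH/pf.
Qed.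

(** Equality on an open set is equality near each of its points, so it passes to partial
    derivatives. This allows replacing a derivative by a product or chain rule formula that is valid
    on U only. *)
Lemma ck_eq k U f g : open U -> (forall x, U x -> f x = g x) ->
  ck k U f -> ck k U g.
Proof.
move=> oU; have nfg f' g' x : (forall x, U x -> f' x = g' x) -> U x ->
    \forall y \near x, f' y = g' y.
  move=> fg Ux; apply: filterS (open_nbhs_nbhs (conj oU Ux)) => y; exact: fg.
elim: k f g => [|k IH] f g fg [df pf]; split => //.
- move=> x Ux; apply: (near_eq_differentiable (nfg _ _ _ fg Ux)); exact: df.
- move=> x Ux; apply: (near_eq_differentiable (nfg _ _ _ fg Ux)); exact: df.
- move=> i; apply: IH (pf i) => x Ux; exact: near_eq_partial (nfg _ _ _ fg Ux).
Qed.

Lemma ck_cst k U (a : R) : open U -> ck k U (fun=> a).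
Proof.
move=> oU; elim: k a => [|k IH] a; split => // i.
by apply: (ck_eq (f := fun=> 0)) (IH 0) => // x _; rewrite partial_cst.
Qed.

Lemma ckD k U f g : open U -> ck k U f -> ck k U g ->
  ck k U (fun x => f x + g x).
Proof.
move=> oU; elim: k f g => [|k IH] f g [df pf] [dg pg]; split => //;
  [move=> x Ux|move=> x Ux|move=> i].
- by apply: differentiableD; [exact: df|exact: dg].
- by apply: differentiableD; [exact: df|exact: dg].
- apply: ck_eq (IH _ _ (pf i) (pg i)) => // x Ux.
  by rewrite partialD//; [exact: df|exact: dg].
Qed.

Lemma ckN k U f : open U -> ck k U f -> ck k U (fun x => - f x).
Proof.
move=> oU; elim: k f => [|k IH] f [df pf]; split => //;
  [move=> x Ux|move=> x Ux|move=> i].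
- by apply: differentiableN; exact: df.
- by apply: differentiableN; exact: df.
- by apply: ck_eq (IH _ (pf i)) => // x Ux; rewrite partialN//; exact: df.
Qed.

Lemma ckM k U f g : open U -> ck k U f -> ck k U g ->
  ck k U (fun x => f x * g x).
Proof.
move=> oU; elim: k f g => [|k IH] f g cf cg; split => //;
  [move=> x Ux|move=> x Ux|move=> i].
- by apply: differentiableM; [exact: ck_diff cf Ux|exact: ck_diff cg Ux].
- by apply: differentiableM; [exact: ck_diff cf Ux|exact: ck_diff cg Ux].
- apply: (ck_eq (f := fun x => partial i f x * g x + f x * partial i g x)) => //.
    by move=> x Ux; rewrite partialM//; [exact: ck_diff cf Ux|exact: ck_diff cg Ux].
  case: (cf) => _ pf; case: (cg) => _ pg.
  (* Each term pairs a derivative of one factor with the other factor itself, which [ckW] brings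
     down to order k. *)
  by apply: ckD => //; apply: IH;
    (exact: pf || exact: pg || exact: ckW cf || exact: ckW cg).
Qed.

Lemma ck_sum k U (I : Type) (r : seq I) (P : pred I) (F : I -> 'rV[R]_n -> R) :
  open U -> (forall a, P a -> ck k U (F a)) ->
  ck k U (fun x => \sum_(a <- r | P a) F a x).
Proof.
move=> oU cF; elim: r => [|a r IH].
  by apply: ck_eq (ck_cst k _ oU) => // x _; rewrite big_nil.
rewrite (_ : (fun y => _) = fun y => if P a then F a y + \sum_(k <- r | P k) F k y
    else \sum_(k <- r | P k) F k y); last by apply/funext => y; rewrite big_cons.
case Pa: (P a) => //.
by apply: ckD => //; exact: cF.
Qed.

Lemma ck_prod k U (I : Type) (r : seq I) (P : pred I) (F : I -> 'rV[R]_n -> R) :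
  open U -> (forall a, P a -> ck k U (F a)) ->
  ck k U (fun x => \prod_(a <- r | P a) F a x).
Proof.
move=> oU cF; elim: r => [|a r IH].
  by apply: ck_eq (ck_cst k _ oU) => // x _; rewrite big_nil.
rewrite (_ : (fun y => _) = fun y => if P a then F a y * \prod_(k <- r | P k) F k y
    else \prod_(k <- r | P k) F k y); last by apply/funext => y; rewrite big_cons.
case Pa: (P a) => //.
by apply: ckM => //; exact: cF.
Qed.

(** The derivative - f' (1/f)^2 involves 1/f undifferentiated, so the induction hypothesis on 1/f
    itself controls it. *)
Lemma ckV k U f : open U -> (forall x, U x -> f x != 0) -> ck k U f ->
  ck k U (fun x => (f x)^-1).
Proof.
move=> oU f0; elim: k => [|k IH] cf; split => //;
  [move=> x Ux|move=> x Ux|move=> i].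
- by apply: differentiableV; [exact: ck_diff cf Ux|exact: f0].
- by apply: differentiableV; [exact: ck_diff cf Ux|exact: f0].
- apply: (ck_eq (f := fun x => - partial i f x * ((f x)^-1 * (f x)^-1))) => //.
    by move=> x Ux; rewrite partialV ?f0//; exact: ck_diff cf Ux.
  case: (cf) => _ pf; have cV := IH (ckW cf).
  by apply: ckM => //; [apply: ckN => //; exact: pf|exact: ckM].
Qed.

Lemma ck_coord k (p q : nat) U (F : 'rV[R]_n -> 'M[R]_(p, q)) :
  open U -> smooth_on U F -> forall a b, ck k U (fun x => F x a b).
Proof.
(* Generalised over the word s: taking one more partial derivative prepends a basis vector to s. *)
move=> oU sF a b; suff : forall s, ck k U (fun x => iter_derive s F x a b).
  by move=> /(_ [::]).
have dF s x (Ux : U x) : differentiable (fun x => iter_derive s F x a b) x.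
  apply: (differentiable_comp (f := iter_derive s F) (g := fun N => N a b)).
    exact: sF.
  exact: differentiable_coord.
elim: k => [|k IH] s; split => //; try exact: dF.
move=> i; apply: ck_eq (IH (delta_mx 0 i :: s)) => // x Ux.
by rewrite /= derive_mx ?mxE//; apply: diff_derivable; exact: sF.
Qed.

End ck.

(** By the chain rule the derivatives involve [partial a h] composed with phi, hence an induction
    for all h with phi fixed. *)
Lemma ck_comp (R : realType) (n m k : nat) (U : set 'rV[R]_n) (V : set 'rV[R]_m)
    (phi : 'rV[R]_n -> 'rV[R]_m) (h : 'rV[R]_m -> R) :
  open U -> (forall x, U x -> V (phi x)) ->
  (forall x, U x -> differentiable phi x) ->
  (forall a, ck k U (fun x => phi x 0 a)) -> ck k V h -> ck k U (h \o phi).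
Proof.
move=> oU UV dphi; elim: k h => [|k IH] h cphi ch; split => //;
  [move=> x Ux|move=> x Ux|move=> i].
- by apply: differentiable_comp; [exact: dphi|exact: ck_diff ch (UV _ Ux)].
- by apply: differentiable_comp; [exact: dphi|exact: ck_diff ch (UV _ Ux)].
- apply: (ck_eq (f := fun x =>
    \sum_a partial i (fun y => phi y 0 a) x * (partial a h \o phi) x)) => //.
    move=> x Ux; rewrite partial_comp//; first exact: dphi.
    exact: ck_diff ch (UV _ Ux).
  apply: ck_sum => // a _; case: (cphi a) => _ pphi; case: (ch) => _ ph.
  by apply: ckM => //; [exact: pphi|apply: IH; [move=> b; exact: ckW|exact: ph]].
Qed.

(** * Symmetry of second derivatives and matrix-valued functions *)

Section lines.
Context (R : realType) (V : normedModType R).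
Implicit Types (f : V -> R) (x v w : V).

Lemma is_derive_line f x v (s : R) : derivable f (s *: v + x) v ->
  is_derive s 1 (fun h : R => f (h *: v + x)) ('D_v f (s *: v + x)).
Proof.
move=> df; set F := fun h : R => _.
have E : (fun h : R => h^-1 *: ((F \o shift s) (h *: (1 : R)) - F s)) =
    fun h : R => h^-1 *: ((f \o shift (s *: v + x)) (h *: v) - f (s *: v + x)).
  by apply/funext => h; rewrite /F/= [h *: _]mulr1 scalerDl addrA.
by apply: DeriveDef; rewrite /derivable ?/derive E.
Qed.

Lemma MVT_line f x v (h : R) : 0 < h ->
  (forall s, 0 <= s <= h -> differentiable f (s *: v + x)) ->
  exists2 s, 0 < s < h & f (h *: v + x) - f x = 'D_v f (s *: v + x) * h.
Proof.
move=> h0 df; pose F s := f (s *: v + x).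
have dF s : 0 <= s <= h -> is_derive s 1 F ('D_v f (s *: v + x)).
  by move=> sh; apply/is_derive_line/diff_derivable/df.
have [s||s] := @MVT R F (fun s => 'D_v f (s *: v + x)) 0 h h0.
- by rewrite in_itv/= => /andP[s0 sh]; apply: dF; rewrite !ltW.
- apply: derivable_within_continuous => s; rewrite in_itv/= => sh.
  by have [] := dF _ sh.
- by rewrite in_itv/= /F scale0r add0r subr0 => sh ->; exists s.
Qed.

Lemma ball_line x v e (s h : R) : ball x e (h *: v + x) -> 0 <= s <= h ->
  ball x e (s *: v + x).
Proof.
rewrite -!ball_normE/= !opprD ![x + _]addrC !addrNK !normrN !normrZ => b /andP[s0 sh].
apply: le_lt_trans b; rewrite ler_wpM2r// !ger0_norm//; exact: le_trans sh.
Qed.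

Lemma near_square (P : set V) x v w : (\forall y \near x, P y) ->
  exists2 h : R, 0 < h & forall s t : R, 0 <= s <= h -> 0 <= t <= h ->
    P (t *: w + (s *: v + x)).
Proof.
move=> /nbhs_ballP[e /= e0 xP].
have m0 : 0 < `|v| + `|w| + 1 by rewrite ltr_wpDl// addr_ge0.
(* The added 1 keeps the denominator positive when v = w = 0; the points reached lie within e / 2 of
   x. *)
exists (e / 2 / (`|v| + `|w| + 1)) => [|s t]; first by rewrite !divr_gt0.
move=> /andP[s0 sh] /andP[t0 th]; apply: xP; rewrite -ball_normE/=.
have -> : x - (t *: w + (s *: v + x)) = - (t *: w + s *: v).
  by rewrite [in LHS]addrA opprD addrCA subrr addr0.
rewrite normrN (le_lt_trans (ler_normD _ _))// !normrZ !ger0_norm//.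
rewrite (@le_lt_trans _ _ (e / 2))//; last first.
  by rewrite ltr_pdivrMr// mulr_natr mulr2n ltrDl.
rewrite (@le_trans _ _ (e / 2 / (`|v| + `|w| + 1) * (`|v| + `|w|)))//.
  by rewrite mulrDr addrC lerD// ler_wpM2r.
rewrite -mulrA ler_piMr ?divr_ge0 ?ltW//.
by rewrite mulrC ltr_pdivrMr// mul1r ltrDl.
Qed.

Lemma derive_translate f x v w :
  'D_v (fun y => f (w + y)) x = 'D_v f (w + x).
Proof.
have E :
    (fun h : R => h^-1 *: (((fun y => f (w + y)) \o shift x) (h *: v) - f (w + x))) =
    fun h : R => h^-1 *: ((f \o shift (w + x)) (h *: v) - f (w + x)).
  by apply/funext => h /=; rewrite addrCA.
by rewrite /derive E.
Qed.

(** Two mean value theorems: along v for y |-> f (h w + y) - f y, then along w for ['D_v f]. *)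
Lemma second_difference f x v w (h : R) : 0 < h ->
  (forall s t, 0 <= s <= h -> 0 <= t <= h ->
    differentiable f (t *: w + (s *: v + x)) /\
    differentiable ('D_v f) (t *: w + (s *: v + x))) ->
  exists s t, [/\ 0 < s < h, 0 < t < h &
    f (h *: w + (h *: v + x)) - f (h *: v + x) - (f (h *: w + x) - f x) =
    'D_w ('D_v f) (t *: w + (s *: v + x)) * h * h].
Proof.
move=> h0 df; have h00 : 0 <= (0 : R) <= h by rewrite lexx ltW.
have hh : 0 <= h <= h by rewrite lexx ltW.
pose g y := f (h *: w + y) - f y.
have dfh s : 0 <= s <= h -> differentiable (fun y => f (h *: w + y)) (s *: v + x).
  move=> sh; apply: (differentiable_comp (f := fun y => h *: w + y) (g := f)) => //.
  by have [] := df s h sh hh.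
have df0 s : 0 <= s <= h -> differentiable f (s *: v + x).
  by move=> sh; have [] := df s 0 sh h00; rewrite scale0r add0r.
have [|s sh E] := @MVT_line g x v h h0.
  by move=> s sh; apply: differentiableB; [exact: dfh|exact: df0].
have sh' : 0 <= s <= h by case/andP: sh => s0 sh; rewrite !ltW.
have [|t th E'] := @MVT_line ('D_v f) (s *: v + x) w h h0.
  by move=> t th; have [] := df s t sh' th.
exists s, t; split => //; rewrite -/(g (h *: v + x)) -/(g x) E; congr (_ * _).
rewrite -E' /g deriveB.
- by rewrite derive_translate.
- exact/diff_derivable/dfh.
- exact/diff_derivable/df0.
Qed.

(** The second difference is symmetric in v and w, so both mixed derivatives take a common value,
    the difference divided by h^2, at points arbitrarily close to x. Continuity at x concludes. *)
Lemma derive_schwarz f x v w :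
  (\forall y \near x, differentiable f y) ->
  (\forall y \near x, differentiable ('D_v f) y) ->
  (\forall y \near x, differentiable ('D_w f) y) ->
  {for x, continuous ('D_w ('D_v f))} -> {for x, continuous ('D_v ('D_w f))} ->
  'D_w ('D_v f) x = 'D_v ('D_w f) x.
Proof.
have D (p q r s : R) : p - q - (r - s) = p - r - (q - s) by lra.
have T (p q r e : R) : `|p - r| < e / 2 -> `|r - q| < e / 2 -> `|p - q| < e.
  move=> pr rq; apply: le_lt_trans (ler_distD r p q) _.
  by rewrite (splitr e); exact: ltrD.
move=> df dv dw cvw cwv; set a := LHS; set b := RHS.
apply/eqP; rewrite -subr_eq0 -normr_le0; apply/ler_addgt0Pr => e e0; rewrite add0r.
have e2 : 0 < e / 2 by rewrite divr_gt0.
have nvw : \forall y \near x, `|a - 'D_w ('D_v f) y| < e / 2.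
  by move/cvgrPdist_lt: cvw => /(_ _ e2).
have nwv : \forall y \near x, `|b - 'D_v ('D_w f) y| < e / 2.
  by move/cvgrPdist_lt: cwv => /(_ _ e2).
pose P y := [/\ differentiable f y /\ differentiable ('D_v f) y,
   differentiable ('D_w f) y, `|a - 'D_w ('D_v f) y| < e / 2 &
   `|b - 'D_v ('D_w f) y| < e / 2].
have nP : \forall y \near x, P y.
  apply: filterS (filterI (filterI df dv) (filterI dw (filterI nvw nwv))).
  by move=> y [[? ?] [? [? ?]]].
have [h1 h10 P1] := near_square v w nP; have [h2 h20 P2] := near_square w v nP.
pose h := Num.min h1 h2; have h0 : 0 < h by rewrite lt_min h10.
have hh1 s : 0 <= s <= h -> 0 <= s <= h1.
  by move=> /andP[-> sh]; rewrite (le_trans sh)// ge_min lexx.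
have hh2 s : 0 <= s <= h -> 0 <= s <= h2.
  by move=> /andP[-> sh]; rewrite (le_trans sh)// ge_min lexx orbT.
have lth s : 0 < s < h -> 0 <= s <= h by move=> /andP[s0 sh]; rewrite !ltW.
have [|s [t [sh th E]]] := @second_difference f x v w h h0.
  by move=> s t /hh1 ps /hh1 pt; have [[? ?] _ _ _] := P1 _ _ ps pt.
have [|s' [t' [sh' th' E']]] := @second_difference f x w v h h0.
  by move=> s' t' /hh2 ps /hh2 pt; have [[? _] ? _ _] := P2 _ _ ps pt.
have {E'}E' : 'D_w ('D_v f) (t *: w + (s *: v + x)) =
    'D_v ('D_w f) (t' *: v + (s' *: w + x)).
  apply: (mulIf (lt0r_neq0 h0)); apply: (mulIf (lt0r_neq0 h0)).
  apply: etrans (esym E) (etrans _ E').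
  have -> : h *: w + (h *: v + x) = h *: v + (h *: w + x) by rewrite addrCA.
  exact: D.
have [_ _ Ha _] := P1 _ _ (hh1 _ (lth _ sh)) (hh1 _ (lth _ th)).
have [_ _ _ Hb] := P2 _ _ (hh2 _ (lth _ sh')) (hh2 _ (lth _ th')).
rewrite -E' distrC in Hb; apply/ltW.
exact: T Ha Hb.
Qed.

Lemma derive0_line f x v (e : R) : (forall y, ball x e y -> differentiable f y) ->
  (forall y, ball x e y -> 'D_v f y = 0) -> ball x e (v + x) -> f (v + x) = f x.
Proof.
rewrite -[v in v + _]scale1r => df dv0 b.
have [|s /andP[s0 s1]] := @MVT_line f x v 1 ltr01.
  by move=> s sh; exact/df/(ball_line b).
rewrite dv0 ?mul0r; first by move=> /eqP; rewrite subr_eq0 => /eqP.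
by apply: (ball_line b); rewrite !ltW.
Qed.

End lines.

(** Segments from the centre stay in the ball, and the derivative along y - x is a combination of
    partial derivatives. *)
Lemma partial0_ball (R : realType) (n : nat) (f : 'rV[R]_n -> R) x (e : R) :
  (forall y, ball x e y -> differentiable f y) ->
  (forall i y, ball x e y -> partial i f y = 0) ->
  forall y, ball x e y -> f y = f x.
Proof.
move=> df d0 y xy; rewrite -[y](subrK x); apply: (@derive0_line _ _ _ _ _ e) => //.
- move=> z xz; rewrite deriveE; last exact: df.
  rewrite [y - x]row_sum_delta linear_sum/= big1// => i _.
  by rewrite linearZ/= -deriveE ?[derive _ _ _]d0 ?scaler0//; exact: df.
- by rewrite subrK.
Qed.

Section schwarz.
Context (R : realType) (n : nat).
Implicit Types (f g : 'rV[R]_n -> R) (x : 'rV[R]_n) (U : set 'rV[R]_n).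

(** Order 2 in [ck] makes the second partial derivatives differentiable, hence continuous, as
    [derive_schwarz] requires. *)
Lemma partialC U f i j x : open U -> ck 2 U f -> U x ->
  partial i (partial j f) x = partial j (partial i f) x.
Proof.
move=> oU [df pf] Ux; have {}pf k : ck 1 U (partial k f) by exact: pf.
have dpf k y : U y -> differentiable (partial k f) y.
  by move=> Uy; exact: ck_diff (pf k) Uy.
have nU (P : 'rV[R]_n -> Prop) : (forall y, U y -> P y) -> \forall y \near x, P y.
  by move=> UP; apply: filterS (open_nbhs_nbhs (conj oU Ux)).
have c0 a b : differentiable (partial a (partial b f)) x.
  by case: (pf b) => _ /(_ a)[+ _]; apply.
apply: (@derive_schwarz _ _ f x (delta_mx 0 j) (delta_mx 0 i)).
- by apply: nU => y; exact: df.
- by apply: nU => y; exact: dpf.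
- by apply: nU => y; exact: dpf.
- exact/differentiable_continuous/c0.
- exact/differentiable_continuous/c0.
Qed.

End schwarz.

(* Locked: unification must not unfold the derivatives down to limits. *)
HB.lock Definition dmx (R : realType) (n : nat) (i : 'I_n) p q
    (F : 'rV[R]_n -> 'M[R]_(p, q)) (x : 'rV[R]_n) : 'M[R]_(p, q) :=
  \matrix_(a, b) partial i (fun y => F y a b) x.

(** * Entrywise calculus of matrix-valued functions *)

Section matrix_valued.
Context (R : realType) (n : nat).
Implicit Types (x : 'rV[R]_n) (U : set 'rV[R]_n) (i j : 'I_n).

Definition cmx k U p q (F : 'rV[R]_n -> 'M[R]_(p, q)) :=
  forall a b, ck k U (fun x => F x a b).

Lemma dmxE i p q (F : 'rV[R]_n -> 'M[R]_(p, q)) x a b :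
  dmx i F x a b = partial i (fun y => F y a b) x.
Proof. by rewrite dmx.unlock mxE. Qed.

Lemma cmx_diff k U p q (F : 'rV[R]_n -> 'M[R]_(p, q)) x a b :
  cmx k U F -> U x -> differentiable (fun y => F y a b) x.
Proof. by move=> cF; exact: ck_diff (cF a b). Qed.

Lemma cmx_eq k U p q (F G : 'rV[R]_n -> 'M[R]_(p, q)) : open U ->
  (forall x, U x -> F x = G x) -> cmx k U F -> cmx k U G.
Proof. by move=> oU FG cF a b; apply: ck_eq (cF a b) => // x /FG ->. Qed.

Lemma dmx_eq U i p q (F G : 'rV[R]_n -> 'M[R]_(p, q)) x : open U ->
  (forall x, U x -> F x = G x) -> U x -> dmx i F x = dmx i G x.
Proof.
move=> oU FG Ux; apply/matrixP => a b; rewrite !dmxE; apply: near_eq_partial.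
by apply: filterS (open_nbhs_nbhs (conj oU Ux)) => y /FG ->.
Qed.

Lemma cmx_dmx k U i p q (F : 'rV[R]_n -> 'M[R]_(p, q)) : open U ->
  cmx k.+1 U F -> cmx k U (dmx i F).
Proof.
move=> oU cF a b; case: (cF a b) => _ /(_ i).
by apply: ck_eq => // x _; rewrite dmxE.
Qed.

Lemma cmxD k U p q (F G : 'rV[R]_n -> 'M[R]_(p, q)) : open U ->
  cmx k U F -> cmx k U G -> cmx k U (fun x => F x + G x).
Proof.
move=> oU cF cG a b; apply: (ck_eq _ _ (ckD oU (cF a b) (cG a b))) => // x _.
by rewrite mxE.
Qed.

Lemma cmxN k U p q (F : 'rV[R]_n -> 'M[R]_(p, q)) : open U ->
  cmx k U F -> cmx k U (fun x => - F x).
Proof.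
move=> oU cF a b; apply: (ck_eq _ _ (ckN oU (cF a b))) => // x _.
by rewrite mxE.
Qed.

Lemma cmx_tr k U p q (F : 'rV[R]_n -> 'M[R]_(p, q)) : open U ->
  cmx k U F -> cmx k U (fun x => (F x)^T).
Proof. by move=> oU cF a b; apply: (ck_eq _ _ (cF b a)) => // x _; rewrite mxE. Qed.

Lemma cmxM k U p q r (F : 'rV[R]_n -> 'M[R]_(p, q)) (G : 'rV[R]_n -> 'M[R]_(q, r)) :
  open U -> cmx k U F -> cmx k U G -> cmx k U (fun x => F x *m G x).
Proof.
move=> oU cF cG a b; apply: (@ck_eq _ _ _ _ (fun x => \sum_c F x a c * G x c b)) => //.
  by move=> x _; rewrite mxE.
by apply: ck_sum => // c _; exact: ckM.
Qed.

Lemma cmxZ k U p q (f : 'rV[R]_n -> R) (F : 'rV[R]_n -> 'M[R]_(p, q)) : open U ->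
  ck k U f -> cmx k U F -> cmx k U (fun x => f x *: F x).
Proof.
move=> oU cf cF a b; apply: (ck_eq _ _ (ckM oU cf (cF a b))) => // x _.
by rewrite mxE.
Qed.

Lemma cmx_sum k U p q (I : Type) (s : seq I) (P : pred I)
    (F : I -> 'rV[R]_n -> 'M[R]_(p, q)) : open U ->
  (forall c, P c -> cmx k U (F c)) ->
  cmx k U (fun x => \sum_(c <- s | P c) F c x).
Proof.
move=> oU cF a b.
apply: (@ck_eq _ _ _ _ (fun x => \sum_(c <- s | P c) F c x a b)) => //.
  by move=> x _; rewrite summxE.
by apply: ck_sum => // c Pc; exact: cF.
Qed.

Lemma ck_det k U p (F : 'rV[R]_n -> 'M[R]_p) : open U -> cmx k U F ->
  ck k U (fun x => \det (F x)).
Proof.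
move=> oU cF; apply: ck_sum => // s _; apply: ckM => //; first exact: ck_cst.
by apply: ck_prod.
Qed.

(** The adjugate formula writes the inverse through determinants, divided by one that does not
    vanish on U. *)
Lemma cmx_inv k U p (F : 'rV[R]_n -> 'M[R]_p) : open U ->
  (forall x, U x -> F x \in unitmx) -> cmx k U F -> cmx k U (fun x => invmx (F x)).
Proof.
move=> oU uF cF.
apply: (@cmx_eq _ _ _ _ (fun x => (\det (F x))^-1 *: \adj (F x))) => //.
  by move=> x Ux; rewrite /invmx uF.
apply: cmxZ => //.
  apply: ckV => //; last exact: ck_det.
  by move=> x Ux; have := uF x Ux; rewrite unitmxE unitfE.
move=> a b; apply: (@ck_eq _ _ _ _ (fun x => cofactor (F x) b a)) => //.
  by move=> x _; rewrite mxE.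
apply: ckM => //; first exact: ck_cst.
apply: ck_det => // c d; apply: (ck_eq _ _ (cF (lift b c) (lift a d))) => // x _.
by rewrite !mxE.
Qed.

Lemma dmxD i p q (F G : 'rV[R]_n -> 'M[R]_(p, q)) k U x :
  cmx k U F -> cmx k U G -> U x ->
  dmx i (fun y => F y + G y) x = dmx i F x + dmx i G x.
Proof.
move=> cF cG Ux; apply/matrixP => a b; rewrite dmxE !mxE !dmxE -partialD.
- by congr (partial i _ x); apply/funext => y; rewrite mxE.
- exact: cmx_diff cF Ux.
- exact: cmx_diff cG Ux.
Qed.

Lemma dmxN i p q (F : 'rV[R]_n -> 'M[R]_(p, q)) k U x :
  cmx k U F -> U x -> dmx i (fun y => - F y) x = - dmx i F x.
Proof.
move=> cF Ux; apply/matrixP => a b; rewrite dmxE !mxE !dmxE -partialN.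
- by congr (partial i _ x); apply/funext => y; rewrite mxE.
- exact: cmx_diff cF Ux.
Qed.

Lemma dmx_tr i p q (F : 'rV[R]_n -> 'M[R]_(p, q)) x :
  dmx i (fun y => (F y)^T) x = (dmx i F x)^T.
Proof.
apply/matrixP => a b; rewrite ?mxE !dmxE.
by congr (partial i _ x); apply/funext => y; rewrite mxE.
Qed.

Lemma dmxM i p q r (F : 'rV[R]_n -> 'M[R]_(p, q)) (G : 'rV[R]_n -> 'M[R]_(q, r))
    k U x : cmx k U F -> cmx k U G -> U x ->
  dmx i (fun y => F y *m G y) x = dmx i F x *m G x + F x *m dmx i G x.
Proof.
move=> cF cG Ux; apply/matrixP => a b; rewrite ?mxE !dmxE.
rewrite (_ : (fun y => _) = fun y => \sum_c F y a c * G y c b); last first.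
  by apply/funext => y; rewrite mxE.
have dF c : differentiable (fun y => F y a c) x by exact: cmx_diff cF Ux.
have dG c : differentiable (fun y => G y c b) x by exact: cmx_diff cG Ux.
rewrite partial_sum -?big_split/=; last by move=> c _; exact: differentiableM.
by apply: eq_bigr => c _; rewrite partialM// !dmxE.
Qed.

Lemma dmxZ i p q (f : 'rV[R]_n -> R) (F : 'rV[R]_n -> 'M[R]_(p, q)) k U x :
  ck k U f -> cmx k U F -> U x ->
  dmx i (fun y => f y *: F y) x = partial i f x *: F x + f x *: dmx i F x.
Proof.
move=> cf cF Ux; apply/matrixP => a b; rewrite dmxE !mxE !dmxE -partialM.
- by congr (partial i _ x); apply/funext => y; rewrite mxE.
- exact: ck_diff cf Ux.
- exact: cmx_diff cF Ux.
Qed.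

Lemma dmx_sum i p q (I : Type) (s : seq I) (P : pred I)
    (F : I -> 'rV[R]_n -> 'M[R]_(p, q)) k U x :
  (forall c, P c -> cmx k U (F c)) -> U x ->
  dmx i (fun y => \sum_(c <- s | P c) F c y) x = \sum_(c <- s | P c) dmx i (F c) x.
Proof.
move=> cF Ux; apply/matrixP => a b; rewrite dmxE summxE.
rewrite (_ : (fun y => _) = fun y => \sum_(c <- s | P c) F c y a b); last first.
  by apply/funext => y; rewrite summxE.
rewrite partial_sum; first by apply: eq_bigr => c _; rewrite dmxE.
by move=> c Pc; exact: cmx_diff (cF c Pc) Ux.
Qed.

Lemma dmxC U p q (F : 'rV[R]_n -> 'M[R]_(p, q)) i j x : open U -> cmx 2 U F -> U x ->
  dmx i (dmx j F) x = dmx j (dmx i F) x.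
Proof.
move=> oU cF Ux; apply/matrixP => a b.
have E c : (fun y => dmx c F y a b) = partial c (fun y => F y a b).
  by apply/funext => y; exact: dmxE.
apply: etrans (dmxE _ _ _ _ _) (etrans _ (esym (dmxE _ _ _ _ _))).
rewrite (E i) (E j).
exact: partialC (cF a b) Ux.
Qed.

End matrix_valued.

(** * Levi-Civita connection and curvature *)

Section matrix_entries.
Context (R : pzRingType) (p q : nat).
Implicit Types A B : 'M[R]_(p, q).

Lemma addmxE A B i j : (A + B) i j = A i j + B i j. Proof. by rewrite mxE. Qed.
Lemma oppmxE A i j : (- A) i j = - A i j. Proof. by rewrite mxE. Qed.
Lemma trmxE A i j : A^T i j = A j i. Proof. by rewrite mxE. Qed.
Lemma scalemxE a A i j : (a *: A) i j = a * A i j. Proof. by rewrite mxE. Qed.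

End matrix_entries.

Lemma mulmx_sumE (R : pzRingType) p q r (A : 'M[R]_(p, q)) (B : 'M[R]_(q, r)) i j :
  (A *m B) i j = \sum_k A i k * B k j.
Proof. by rewrite mxE. Qed.

(** Matrix products are left out on purpose: their entries stay atoms, and [lra] closes identities
    linear in them. *)
Definition linmxE := (addmxE, oppmxE, trmxE, scalemxE).

HB.lock Definition Gam (R : realType) (n : nat) (G : 'rV[R]_n -> 'M[R]_n)
    (i : 'I_n) (x : 'rV[R]_n) : 'M[R]_n :=
  \matrix_(j, l) christoffel G l i j x.

HB.lock Definition Curv (R : realType) (n : nat) (G : 'rV[R]_n -> 'M[R]_n)
    (i j : 'I_n) (x : 'rV[R]_n) : 'M[R]_n :=
  \matrix_(k, l) riemann G l k i j x.

Section local_geometry.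
Context (R : realType) (n : nat).
Implicit Types (G : 'rV[R]_n -> 'M[R]_n) (x : 'rV[R]_n) (U : set 'rV[R]_n).
Implicit Types (i j l m : 'I_n).

(** The entry (j, m) is 2 g(nabla_{e_i} e_j, e_m), twice a Christoffel symbol of the first kind. *)
Definition Koszul G i x : 'M[R]_n :=
  \matrix_(j, m) (dmx i G x j m + dmx j G x i m - dmx m G x i j).

Lemma Gam_entry G i x j l : Gam G i x j l = christoffel G l i j x.
Proof. by rewrite Gam.unlock mxE. Qed.

Lemma Curv_entry G i j x k l : Curv G i j x k l = riemann G l k i j x.
Proof. by rewrite Curv.unlock mxE. Qed.

Lemma Koszul_entry G i x j m :
  Koszul G i x j m = dmx i G x j m + dmx j G x i m - dmx m G x i j.
Proof. by rewrite mxE. Qed.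

(** [christoffel] uses the entry (l, m) of the inverse and the matrix product the entry (m, l);
    symmetry of [G x] reconciles them. *)
Lemma GamE G i x : (G x)^T = G x ->
  Gam G i x = 2^-1 *: (Koszul G i x *m invmx (G x)).
Proof.
move=> sG; apply/matrixP => j l; rewrite Gam_entry scalemxE mulmx_sumE; congr (_ * _).
apply: eq_bigr => m _; rewrite Koszul_entry !dmxE mulrC.
by rewrite -[in LHS]sG -trmx_inv trmxE.
Qed.

(** Uniqueness of the torsion-free metric connection, at a single point: the Koszul combination of
    the derivatives of G reduces to 2 K_i G. It lets [Gam_change] identify a transformed connection
    without transforming the Christoffel formula. *)
Lemma Gam_unique G x (K : 'I_n -> 'M[R]_n) : (G x)^T = G x -> G x \in unitmx ->
  (forall i j l, K i j l = K j i l) ->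
  (forall i, dmx i G x = K i *m G x + (K i *m G x)^T) ->
  forall i, Gam G i x = K i.
Proof.
move=> sG uG sK dG i; rewrite GamE//.
suff -> : Koszul G i x = 2 *: (K i *m G x).
  by rewrite -scalemxAl mulmxK// scalerA mulVf ?scale1r// pnatr_eq0.
have sKG a b c : (K a *m G x) b c = (K b *m G x) a c.
  by rewrite !mxE; apply: eq_bigr => d _; rewrite sK.
apply/matrixP => j m; rewrite mxE !dG !linmxE.
rewrite (sKG j i) (sKG m i) (sKG m j); lra.
Qed.

Lemma CurvE G i j x : Curv G i j x =
  dmx i (Gam G j) x - dmx j (Gam G i) x
  + (Gam G j x *m Gam G i x - Gam G i x *m Gam G j x).
Proof.
have E a b c : (fun y => Gam G a y b c) = christoffel G c a b.
  by apply/funext => y; rewrite Gam_entry.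
apply/matrixP => k l; rewrite Curv_entry !linmxE !dmxE !E !mulmx_sumE /riemann -sumrB.
apply: (congr1 (+%R _)); apply: eq_bigr => m _; rewrite !Gam_entry.
exact: (congr2 (fun a b => a - b) (mulrC _ _) (mulrC _ _)).
Qed.

Lemma CurvC G i j x : Curv G j i x = - Curv G i j x.
Proof. by apply/matrixP => k l; rewrite !CurvE !linmxE; lra. Qed.

Lemma ricciE G x j k : local_ricci G x j k = \sum_i Curv G i j x k i.
Proof. by rewrite mxE; apply: eq_bigr => i _; rewrite Curv_entry. Qed.

Lemma scalE G x : local_scal G x = \tr (invmx (G x) *m (local_ricci G x)^T).
Proof.
by apply: eq_bigr => j _; rewrite mulmx_sumE; apply: eq_bigr => k _; rewrite trmxE.
Qed.

(** * Identities for the curvature of one metric *)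

Section one_metric.
Context (U : set 'rV[R]_n) (G : 'rV[R]_n -> 'M[R]_n).
Hypotheses (oU : open U) (cG : forall k, cmx k U G).
Hypotheses (sG : forall x, U x -> (G x)^T = G x)
  (uG : forall x, U x -> G x \in unitmx).

Lemma dmx_sym i x : U x -> (dmx i G x)^T = dmx i G x.
Proof. by move=> Ux; rewrite -dmx_tr; exact: dmx_eq sG Ux. Qed.

Lemma cmx_Gam k i : cmx k U (Gam G i).
Proof.
have cinv : cmx k U (fun x => invmx (G x)) by exact: cmx_inv.
have cp a b c : ck k U (partial a (fun y => G y b c)).
  by case: (cG k.+1 b c) => _; exact.
move=> j l; apply: (@ck_eq _ _ _ _ (christoffel G l i j)) => //.
  by move=> x _; rewrite Gam_entry.
apply: ckM => //; first exact: ck_cst.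
apply: ck_sum => // m _; apply: ckM => //.
by apply: ckD => //; [exact: ckD|exact: ckN].
Qed.

Lemma Gam_sym i j l x : U x -> Gam G i x j l = Gam G j x i l.
Proof.
move=> Ux; rewrite !Gam_entry /christoffel; congr (_ * _); apply: eq_bigr => m _.
have /matrixP/(_ i j) := dmx_sym m Ux; rewrite trmxE !dmxE => ->.
by rewrite [X in _ * (X - _)]addrC.
Qed.

(** Metric compatibility: symmetrising the Koszul expression in its last two indices leaves only 2
    d_i G. *)
Lemma Gam_compat i x : U x -> dmx i G x = Gam G i x *m G x + (Gam G i x *m G x)^T.
Proof.
move=> Ux; rewrite GamE ?sG// -scalemxAl mulmxKV ?uG//.
apply/matrixP => j k; rewrite !linmxE !Koszul_entry.
have -> : dmx i G x k j = dmx i G x j k by rewrite -[in RHS](dmx_sym i Ux) trmxE.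
lra.
Qed.

Lemma cmx_Curv k i j : cmx k U (Curv G i j).
Proof.
have cg := cmx_Gam.
apply: (@cmx_eq _ _ _ _ _ _ (fun x => dmx i (Gam G j) x - dmx j (Gam G i) x
  + (Gam G j x *m Gam G i x - Gam G i x *m Gam G j x))) => //.
  by move=> x _; rewrite CurvE.
apply: cmxD => //; apply: cmxD => //; try apply: cmxN => //.
- exact: cmx_dmx.
- exact: cmx_dmx.
- exact: cmxM.
- exact: cmxM.
Qed.

Lemma cmx_ricci k : cmx k U (local_ricci G).
Proof.
move=> a b; apply: (@ck_eq _ _ _ _ (fun x => \sum_i Curv G i a x b i)) => //.
  by move=> x _; rewrite ricciE.
by apply: ck_sum => // i _; exact: cmx_Curv.
Qed.

Lemma ck_scal k : ck k U (local_scal G).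
Proof.
have cinv : cmx k U (fun x => invmx (G x)) by exact: cmx_inv.
apply: ck_sum => // j _; apply: ck_sum => // l _; apply: ckM => //.
exact: cmx_ricci.
Qed.

(** Expand d_i d_j G = d_j d_i G by metric compatibility, used twice. The terms with G between two
    connection matrices are symmetric in i, j and cancel; what is left is [Curv] times G plus its
    transpose. *)
Lemma Curv_skew i j x : U x -> (Curv G i j x *m G x)^T = - (Curv G i j x *m G x).
Proof.
move=> Ux; have cg := cmx_Gam.
have ddG a b : dmx a (dmx b G) x =
    dmx a (Gam G b) x *m G x + Gam G b x *m dmx a G x
    + (dmx a (Gam G b) x *m G x + Gam G b x *m dmx a G x)^T.
  have cGG : cmx 1 U (fun y => Gam G b y *m G y) by exact: cmxM.
  rewrite (dmx_eq a oU (Gam_compat b) Ux) (dmxD a cGG _ Ux); last exact: cmx_tr.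
  by rewrite dmx_tr (dmxM a (cg 1 b) (cG 1) Ux).
have := dmxC i j oU (cG 2) Ux; rewrite !ddG !Gam_compat//.
rewrite !CurvE !mulmxDr !mulmxDl !mulNmx !trmx_mul !sG//.
rewrite !mulmxA => /matrixP E; apply/matrixP => a b.
move: (E a b); rewrite !linmxE.
have T (A B C : 'M[R]_n) : (A *m B *m C) b a = (C^T *m B^T *m A^T) a b.
  by rewrite -trmx_mul -trmx_mul trmxE mulmxA.
rewrite (T _ _ (Gam G j x)^T) (T _ _ (Gam G i x)^T) !trmxK !sG//; lra.
Qed.

(** The curvature is a skew matrix times the symmetric inverse of G, so its trace equals its own
    opposite. *)
Lemma Curv_tr i j x : U x -> \tr (Curv G i j x) = 0.
Proof.
move=> Ux; have := Curv_skew i j Ux; set W := _ *m _ => skW.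
have -> : Curv G i j x = W *m invmx (G x) by rewrite mulmxK ?uG.
have E : \tr (W *m invmx (G x)) = - \tr (W *m invmx (G x)).
  rewrite -[LHS]mxtrace_tr trmx_mul skW trmx_inv sG// mulmxN.
  by rewrite raddfN/= mxtrace_mulC.
lra.
Qed.

(** Absence of torsion pairs the terms of the cyclic sum: [dS] those in first derivatives, [mS] the
    quadratic ones. *)
Lemma Curv_bianchi1 i j k l x : U x ->
  Curv G i j x k l + Curv G j k x i l + Curv G k i x j l = 0.
Proof.
move=> Ux.
have dS a b c d : dmx a (Gam G b) x c d = dmx a (Gam G c) x b d.
  rewrite !dmxE; apply: near_eq_partial.
  by apply: filterS (open_nbhs_nbhs (conj oU Ux)) => y; exact: Gam_sym.
have mS a b c d : (Gam G a x *m Gam G b x) c d = (Gam G c x *m Gam G b x) a d.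
  by rewrite !mulmx_sumE; apply: eq_bigr => m _; rewrite (Gam_sym _ _ _ Ux).
rewrite !CurvE !linmxE (dS i j k l) (dS j i k l) (dS k j i l).
rewrite (mS j i k l) (mS i j k l) (mS j k i l); lra.
Qed.

(** Trace of the first Bianchi identity: the middle term is the trace of a curvature matrix, which
    is zero. *)
Lemma ricci_sym x : U x -> (local_ricci G x)^T = local_ricci G x.
Proof.
move=> Ux; apply/matrixP => k j; rewrite trmxE !ricciE.
have E : \sum_i (Curv G i j x k i + Curv G j k x i i + Curv G k i x j i) = 0.
  by apply: big1 => i _; exact: Curv_bianchi1.
move: E; rewrite !big_split/= -/(\tr _) Curv_tr// addr0.
under [X in _ + X = _]eq_bigr do rewrite CurvC linmxE.
by rewrite sumrN => /eqP; rewrite subr_eq0 => /eqP.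
Qed.

(** Covariant derivative of R(e_i, e_j) as an endomorphism only: the indices i and j are treated as
    labels. The commutator has the sign dictated by the row convention. *)
Definition covD h i j x : 'M[R]_n :=
  dmx h (Curv G i j) x + (Curv G i j x *m Gam G h x - Gam G h x *m Curv G i j x).

(** Differential Bianchi identity: second derivatives of [Gam] cancel by [dmxC], and the remaining
    products cancel in the cyclic sum. *)
Lemma Curv_bianchi2 h i j x : U x -> covD h i j x + covD i j h x + covD j h i x = 0.
Proof.
move=> Ux; have cg := cmx_Gam.
have dC a b c : dmx a (Curv G b c) x =
  dmx a (dmx b (Gam G c)) x - dmx a (dmx c (Gam G b)) x
  + (dmx a (Gam G c) x *m Gam G b x + Gam G c x *m dmx a (Gam G b) x
     - (dmx a (Gam G b) x *m Gam G c x + Gam G b x *m dmx a (Gam G c) x)).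
  have c1 d e : cmx 1 U (dmx d (Gam G e)) by exact: cmx_dmx.
  have c2 d e : cmx 1 U (fun y => Gam G d y *m Gam G e y) by exact: cmxM.
  have c3 d e : cmx 1 U (fun y => - dmx d (Gam G e) y) by exact: cmxN.
  have c4 d e : cmx 1 U (fun y => - (Gam G d y *m Gam G e y)) by exact: cmxN.
  rewrite (dmx_eq a oU (fun y _ => CurvE G b c y) Ux).
  rewrite (dmxD a (cmxD oU (c1 _ _) (c3 _ _)) (cmxD oU (c2 _ _) (c4 _ _)) Ux).
  rewrite (dmxD a (c1 _ _) (c3 _ _) Ux) (dmxD a (c2 _ _) (c4 _ _) Ux).
  rewrite (dmxN a (c1 _ _) Ux) (dmxN a (c2 _ _) Ux).
  by rewrite !(dmxM a (cg 1 _) (cg 1 _) Ux).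
rewrite /covD !dC !CurvE (dmxC i h oU (cg 2 j) Ux) (dmxC j h oU (cg 2 i) Ux).
rewrite (dmxC j i oU (cg 2 h) Ux).
rewrite !(mulmxDl, mulmxDr, mulNmx, mulmxN) !mulmxA.
apply/matrixP => a b; rewrite [RHS]mxE !linmxE.
lra.
Qed.

End one_metric.
End local_geometry.

(** * Schur's lemma *)

Section schur.
Context (R : realType) (n : nat) (U : set 'rV[R]_n) (G : 'rV[R]_n -> 'M[R]_n).
Hypotheses (oU : open U) (cG : forall k, cmx k U G).
Hypotheses (sG : forall x, U x -> (G x)^T = G x)
  (uG : forall x, U x -> G x \in unitmx).
Implicit Types (x : 'rV[R]_n) (h i j m : 'I_n).

(* The full covariant derivative [(nabla_h R)(e_i, e_j)] of the curvature tensor,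
   as a matrix. *)
Definition covR h i j x : 'M[R]_n :=
  covD G h i j x
  - \sum_m (Gam G h x i m *: Curv G m j x + Gam G h x j m *: Curv G i m x).

(** The terms that distinguish [covR] from [covD] cancel cyclically, [Gam] being symmetric and
    [Curv] antisymmetric in their two form indices. *)
Lemma covR_bianchi h i j x : U x -> covR h i j x + covR i j h x + covR j h i x = 0.
Proof.
move=> Ux; have := Curv_bianchi2 oU cG uG h i j Ux; rewrite /covR.
set c1 := covD _ _ _ _ _; set c2 := covD _ _ _ _ _; set c3 := covD _ _ _ _ _ => c123.
set s1 := \sum_m _; set s2 := \sum_m _; set s3 := \sum_m _.
have s123 : s1 + s2 + s3 = 0.
  rewrite -!big_split/=; apply: big1 => m _.
  have S a b : Gam G a x b m = Gam G b x a m by exact: (Gam_sym oU sG _ _ _ Ux).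
  rewrite (S i h) (S j h) (S j i) (CurvC G i m) (CurvC G h m) (CurvC G j m) !scalerN.
  by apply/matrixP => a b; rewrite [RHS]mxE !linmxE; lra.
have -> : c1 - s1 + (c2 - s2) + (c3 - s3) = (c1 + c2 + c3) - (s1 + s2 + s3).
  by apply/matrixP => a b; rewrite !linmxE; lra.
by rewrite c123 s123 subrr.
Qed.

Lemma covR_antisym h i j x : U x -> covR h j i x = - covR h i j x.
Proof.
move=> Ux; rewrite /covR /covD.
have dC : dmx h (Curv G j i) x = - dmx h (Curv G i j) x.
  rewrite (dmx_eq h oU (fun y _ => CurvC G i j y) Ux).
  by rewrite (dmxN h (cmx_Curv oU cG uG 0 i j) Ux).
rewrite dC (CurvC G i j) -sumrN opprB addrC.
have -> : \sum_m - (Gam G h x j m *: Curv G m i x + Gam G h x i m *: Curv G j m x) =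
  \sum_m (Gam G h x i m *: Curv G m j x + Gam G h x j m *: Curv G i m x).
  apply: eq_bigr => m _; rewrite (CurvC G m j) (CurvC G i m) !scalerN.
  by rewrite opprD !opprK addrC.
by congr (_ + _); rewrite mulNmx mulmxN opprK !opprD opprK.
Qed.

(** The metric is parallel, so covariant differentiation preserves skewness with respect to it. *)
Lemma covR_skew h i j x : U x -> (covR h i j x *m G x)^T = - (covR h i j x *m G x).
Proof.
move=> Ux; have skew a b := Curv_skew oU cG sG uG a b Ux.
have covD_skew : (covD G h i j x *m G x)^T = - (covD G h i j x *m G x).
  have cC := cmx_Curv oU cG uG 0 i j.
  have cCG : cmx 0 U (fun y => Curv G i j y *m G y) by exact: cmxM.
  have : (dmx h (fun y => Curv G i j y *m G y) x)^T =
      - dmx h (fun y => Curv G i j y *m G y) x.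
    rewrite -dmx_tr -(dmxN h cCG Ux).
    exact: dmx_eq oU (fun y Uy => Curv_skew oU cG sG uG i j Uy) Ux.
  rewrite (dmxM h cC (cG 0) Ux) (Gam_compat oU sG uG h Ux) /covD.
  (* With X = Gam Curv G, [covD] times G differs from the derivative of Curv G, which is skew, by
     the skew matrix X^T - X. *)
  have e1 : (Curv G i j x *m (Gam G h x *m G x)^T)^T =
      - (Gam G h x *m Curv G i j x *m G x).
    rewrite trmx_mul trmxK -mulmxA -(mulmxA (Gam G h x)).
    by rewrite -{1}(sG Ux) -trmx_mul skew mulmxN.
  have e2 : Curv G i j x *m (Gam G h x *m G x)^T =
      - (Gam G h x *m Curv G i j x *m G x)^T.
    by rewrite -raddfN/= -e1 trmxK.
  rewrite !(mulmxDl, mulmxDr, mulNmx) !(raddfD, raddfN)/= e1 e2 !mulmxA.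
  move/matrixP => E; apply/matrixP => a b; move: (E a b).
  by rewrite !linmxE; lra.
rewrite /covR mulmxBl raddfB/= covD_skew opprB [RHS]addrC; congr (_ + _).
rewrite mulmx_suml raddf_sum/= -sumrN; apply: eq_bigr => m _.
by rewrite mulmxDl -!scalemxAl raddfD/= !linearZ/= !skew !scalerN opprD !opprK.
Qed.

Context (lam : 'rV[R]_n -> R).
Hypotheses (clam : ck 0 U lam)
  (einstein : forall x, U x -> local_ricci G x = lam x *: G x).

(** Contraction commutes with the covariant derivative, so the left side is nabla_h Ric = nabla_h
    (lam g), and g is parallel. *)
Lemma covR_trace h j k x : U x ->
  \sum_i covR h i j x k i = partial h lam x * G x j k.
Proof.
move=> Ux; have cC k' a b := cmx_Curv oU cG uG k' a b.
have ric a b : \sum_i Curv G i a x b i = lam x * G x a b.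
  by rewrite -ricciE einstein// scalemxE.
have dric : \sum_i dmx h (Curv G i j) x k i =
    partial h lam x * G x j k + lam x * dmx h G x j k.
  have := dmx_eq h oU einstein Ux => /matrixP/(_ j k).
  rewrite (dmxZ h clam (cG 0) Ux) !linmxE => <-; rewrite dmxE.
  have -> : (fun y => local_ricci G y j k) = fun y => \sum_i Curv G i j y k i.
    by apply/funext => y; rewrite ricciE.
  rewrite partial_sum; first by apply: eq_bigr => i _; rewrite dmxE.
  by move=> i _; exact: cmx_diff (cC 0 i j) Ux.
rewrite /covR /covD.
under eq_bigr do rewrite !linmxE summxE !mulmx_sumE.
rewrite !big_split/= dric !sumrN.
have -> : \sum_i \sum_m Gam G h x k m * Curv G i j x m i =
    lam x * (Gam G h x *m G x) k j.
  rewrite exchange_big/= mulmx_sumE mulr_sumr; apply: eq_bigr => m _.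
  by rewrite -mulr_sumr ric mulrCA -[in LHS](sG Ux) trmxE.
have -> : \sum_i \sum_m
      (Gam G h x i m *: Curv G m j x + Gam G h x j m *: Curv G i m x) k i =
    \sum_i \sum_m Curv G i j x k m * Gam G h x m i + lam x * (Gam G h x *m G x) j k.
  under eq_bigr do under eq_bigr do rewrite !linmxE.
  under eq_bigr do rewrite big_split/=.
  rewrite big_split/=; congr (_ + _).
    rewrite exchange_big/=; apply: eq_bigr => m _; apply: eq_bigr => i _.
    exact: mulrC.
  rewrite exchange_big/= mulmx_sumE mulr_sumr; apply: eq_bigr => m _.
  by rewrite -mulr_sumr ric mulrCA.
rewrite (Gam_compat oU sG uG h Ux) !linmxE.
(* The two connection terms acting on the contracted index both equal s, with opposite signs. *)
set s := \sum_i \sum_m _; lra.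
Qed.

(* Contracting the Bianchi identity with g^{jk} delta^i_l, the three terms give
   n d_h lam, - d_h lam and - d_h lam. *)
Lemma schur_derivative h x : U x -> (n%:R - 2) * partial h lam x = 0.
Proof.
move=> Ux; pose g := invmx (G x).
have sg : g^T = g by rewrite trmx_inv sG.
have gG a b : \sum_k g a k * G x k b = (a == b)%:R.
  by rewrite -mulmx_sumE mulVmx ?uG// mxE.
have GG a b : G x a b = G x b a by rewrite -[in LHS](sG Ux) trmxE.
have gG' a b : \sum_k g a k * G x b k = (a == b)%:R.
  by rewrite -gG; apply: eq_bigr => k _; rewrite GG.
(* Skewness expressed with the inverse metric: it exchanges the traced index with the one raised by
   g, which brings the second Bianchi term to the form of [covR_trace]. *)
have gY i j : g *m covR i j h x = - ((covR i j h x)^T *m g).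
  have := covR_skew i j h Ux; rewrite trmx_mul sG// => E.
  have {}E : covR i j h x *m G x = - (G x *m (covR i j h x)^T) by rewrite E opprK.
  rewrite -{1}(mulmxK (uG Ux) (covR i j h x)) -/g E mulNmx mulmxN !mulmxA.
  by rewrite mulVmx ?uG// mul1mx.
have T1 : \sum_j \sum_k g j k * \sum_i covR h i j x k i = n%:R * partial h lam x.
  under eq_bigr do under eq_bigr do rewrite covR_trace// mulrCA.
  under eq_bigr do rewrite -mulr_sumr gG' eqxx mulr1.
  by rewrite sumr_const card_ord mulr_natl.
have T2 : \sum_j \sum_k g j k * \sum_i covR i j h x k i = - partial h lam x.
  under eq_bigr do under eq_bigr do rewrite mulr_sumr.
  under eq_bigr do rewrite exchange_big/=.
  rewrite exchange_big/=.
  have E i : \sum_j \sum_k g j k * covR i j h x k i = - (partial i lam x * (i == h)%:R).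
    under eq_bigr do rewrite -mulmx_sumE gY oppmxE mulmx_sumE.
    rewrite sumrN exchange_big/=; congr (- _); rewrite -gG mulr_sumr.
    apply: eq_bigr => k _; rewrite -mulr_suml; under eq_bigr do rewrite trmxE.
    rewrite covR_trace//.
    have -> : g i k = g k i by rewrite -[in LHS]sg trmxE.
    by rewrite mulrAC mulrA (GG k) mulrAC.
  under eq_bigr do rewrite E.
  rewrite sumrN (bigD1 h)//= eqxx mulr1 big1 ?addr0// => i /negPf ->.
  by rewrite mulr0.
(* Here antisymmetry in the last two form indices is enough to reach [covR_trace]. *)
have T3 : \sum_j \sum_k g j k * \sum_i covR j h i x k i = - partial h lam x.
  have E j k : \sum_i covR j h i x k i = - (partial j lam x * G x h k).
    under eq_bigr => i _ do rewrite (covR_antisym j i h Ux) oppmxE.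
    by rewrite sumrN covR_trace.
  under eq_bigr do under eq_bigr do rewrite E mulrN mulrCA.
  under eq_bigr do rewrite sumrN -mulr_sumr gG'.
  rewrite sumrN (bigD1 h)//= eqxx mulr1 big1 ?addr0// => j /negPf ->.
  by rewrite mulr0.
have : \sum_j \sum_k g j k *
    \sum_i (covR h i j x + covR i j h x + covR j h i x) k i = 0.
  apply: big1 => j _; apply: big1 => k _; rewrite big1 ?mulr0// => i _.
  by rewrite covR_bianchi// mxE.
have -> : \sum_j \sum_k g j k *
    \sum_i (covR h i j x + covR i j h x + covR j h i x) k i =
    \sum_j \sum_k g j k * \sum_i covR h i j x k i +
    \sum_j \sum_k g j k * \sum_i covR i j h x k i +
    \sum_j \sum_k g j k * \sum_i covR j h i x k i.
  rewrite -!big_split/=; apply: eq_bigr => j _.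
  rewrite -!big_split/=; apply: eq_bigr => k _.
  rewrite -!mulrDr -!big_split/=; congr (_ * _).
  by apply: eq_bigr => i _; rewrite !addmxE.
rewrite T1 T2 T3 => E; rewrite mulrBl -[RHS]E -addrA -opprD -mulr2n.
by rewrite mulr_natl.
Qed.

End schur.

(** * Change of coordinates *)

HB.lock Definition jac (R : realType) (n m : nat) (phi : 'rV[R]_n -> 'rV[R]_m)
    (x : 'rV[R]_n) : 'M[R]_(n, m) :=
  \matrix_(i, a) partial i (fun y => phi y 0 a) x.

Lemma jac_entry (R : realType) (n m : nat) (phi : 'rV[R]_n -> 'rV[R]_m) x i a :
  jac phi x i a = partial i (fun y => phi y 0 a) x.
Proof. by rewrite jac.unlock mxE. Qed.

Lemma jacobianE (R : realType) (n m : nat) (phi : 'rV[R]_n -> 'rV[R]_m) x :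
  differentiable phi x -> 'J phi x = jac phi x.
Proof.
move=> dphi; apply/matrixP => i a; rewrite jac_entry /partial.
have -> : 'D_(delta_mx 0 i) (fun y => phi y 0 a) x = ('D_(delta_mx 0 i) phi x) 0 a.
  by rewrite derive_mx ?mxE//; exact: diff_derivable.
by rewrite deriveEjacobian// -rowE [RHS]mxE.
Qed.

Section change_of_coordinates.
Context (R : realType) (n : nat) (U V : set 'rV[R]_n).
Context (phi : 'rV[R]_n -> 'rV[R]_n) (G H : 'rV[R]_n -> 'M[R]_n).
Hypotheses (oU : open U) (oV : open V) (UV : forall x, U x -> V (phi x)).
Hypotheses (dphi : forall x, U x -> differentiable phi x)
  (cphi : forall k a, ck k U (fun x => phi x 0 a)).
Hypotheses (cG : forall k, cmx k U G) (sG : forall x, U x -> (G x)^T = G x)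
  (uG : forall x, U x -> G x \in unitmx).
Hypotheses (cH : forall k, cmx k V H) (sH : forall x, V x -> (H x)^T = H x)
  (uH : forall x, V x -> H x \in unitmx).
Hypothesis GH : forall x, U x ->
  G x = jac phi x *m H (phi x) *m (jac phi x)^T.
Implicit Types (x : 'rV[R]_n) (i j l a b : 'I_n).

Let J := jac phi.

Lemma cmx_jac k : cmx k U J.
Proof.
move=> i a; apply: (@ck_eq _ _ _ _ (partial i (fun y => phi y 0 a))) => //.
  by move=> x _; rewrite /J jac_entry.
by case: (cphi k.+1 a) => _; apply.
Qed.

(** Read off [GH]: J is a factor of the invertible matrix G, so no inverse of phi is involved. *)
Lemma jac_unit x : U x -> J x \in unitmx.
Proof. by move=> Ux; have := uG Ux; rewrite GH// !unitmx_mul => /andP[/andP[]]. Qed.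

Lemma dmx_jac i j a x : U x -> dmx i J x j a = dmx j J x i a.
Proof.
move=> Ux; rewrite !dmxE.
have E c : (fun y => J y c a) = partial c (fun y => phi y 0 a).
  by apply/funext => y; rewrite /J jac_entry.
rewrite (E i) (E j); exact: partialC (cphi 2 a) Ux.
Qed.

Lemma cmx_pullback k p q (F : 'rV[R]_n -> 'M[R]_(p, q)) :
  cmx k V F -> cmx k U (fun x => F (phi x)).
Proof.
by move=> cF a b; apply: (ck_comp (V := V) (h := fun y => F y a b)).
Qed.

Lemma dmx_pullback i p q (F : 'rV[R]_n -> 'M[R]_(p, q)) x : cmx 0 V F -> U x ->
  dmx i (fun y => F (phi y)) x = \sum_a J x i a *: dmx a F (phi x).
Proof.
move=> cF Ux; apply/matrixP => c d; rewrite summxE dmxE.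
rewrite (@partial_comp _ _ i _ phi (fun y => F y c d) x (dphi Ux)); last first.
  exact: cmx_diff cF (UV Ux).
by apply: eq_bigr => a _; rewrite scalemxE dmxE /J jac_entry.
Qed.

(* With [J = jac phi], [pullGam i] is [nabla_{e_i}] of the pulled-back connection in
   the frame pulled back from the target. *)
Definition pullGam i x : 'M[R]_n := \sum_a J x i a *: Gam H a (phi x).

Lemma cmx_pullGam k i : cmx k U (pullGam i).
Proof.
apply: cmx_sum => // a _; apply: cmxZ => //; first exact: cmx_jac.
exact/cmx_pullback/cmx_Gam.
Qed.

(** The candidate (d_i J + J A_i) J^-1 is torsion-free, by symmetry of the second derivatives of phi
    and of [Gam H], and compatible with G, by differentiating [GH]. [Gam_unique] identifies it. *)
Lemma Gam_change i x : U x -> Gam G i x *m J x = dmx i J x + J x *m pullGam i x.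
Proof.
move=> Ux; pose K i := dmx i J x + J x *m pullGam i x.
have uJ := jac_unit Ux.
suff -> : Gam G i x = K i *m invmx (J x) by rewrite mulmxKV.
apply: (@Gam_unique _ _ _ _ (fun i => K i *m invmx (J x))); rewrite ?sG ?uG//.
- move=> {}i j l; rewrite !mulmx_sumE; apply: eq_bigr => b _; congr (_ * _).
  rewrite !addmxE (dmx_jac i) //; congr (_ + _).
  have E c d : (J x *m pullGam c x) d b =
      \sum_a \sum_m J x d m * (J x c a * Gam H a (phi x) m b).
    rewrite mulmx_sumE exchange_big/=; apply: eq_bigr => m _.
    rewrite /pullGam summxE mulr_sumr; apply: eq_bigr => a _.
    by rewrite scalemxE.
  rewrite !E exchange_big/=; apply: eq_bigr => m _; apply: eq_bigr => a _.
  by rewrite mulrCA (Gam_sym oV sH m a b (UV Ux)).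
- move=> {}i.
  have -> : K i *m invmx (J x) *m G x = K i *m H (phi x) *m (J x)^T.
    by rewrite GH// !mulmxA mulmxKV.
  have cHp : cmx 0 U (fun y => H (phi y)) by exact: cmx_pullback.
  have cJ := cmx_jac 0.
  have cJH : cmx 0 U (fun y => J y *m H (phi y)) by exact: cmxM.
  rewrite (dmx_eq i oU GH Ux) (dmxM i cJH (cmx_tr oU cJ) Ux) (dmxM i cJ cHp Ux).
  rewrite dmx_tr dmx_pullback//.
  have -> : \sum_a J x i a *: dmx a H (phi x) =
      pullGam i x *m H (phi x) + (pullGam i x *m H (phi x))^T.
    rewrite /pullGam mulmx_suml raddf_sum/= -big_split/=; apply: eq_bigr => a _.
    rewrite (Gam_compat oV sH uH a (UV Ux)) -scalemxAl scalerDr.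
    by rewrite [(_ *: _)^T]linearZ.
  rewrite /K !(mulmxDl, mulmxDr) !(raddfD)/= !trmx_mul !trmxK !sH; try exact: UV.
  rewrite !mulmxA; apply/matrixP => a b; rewrite !addmxE.
  lra.
Qed.

Definition pullCurv i j x : 'M[R]_n :=
  \sum_a \sum_b (J x i a * J x j b) *: Curv H a b (phi x).

(** The pulled-back curvature is the curvature of the pulled-back connection: the terms containing
    derivatives of J cancel because second derivatives of phi commute. *)
Lemma pullCurvE i j x : U x -> pullCurv i j x =
  dmx i (pullGam j) x - dmx j (pullGam i) x
  + (pullGam j x *m pullGam i x - pullGam i x *m pullGam j x).
Proof.
move=> Ux.
have cJ a b : ck 0 U (fun x => J x a b) by exact: cmx_jac.
have cgH k a : cmx k V (Gam H a) by exact: cmx_Gam.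
have dA c d : dmx c (pullGam d) x = \sum_a dmx c J x d a *: Gam H a (phi x) +
   \sum_a \sum_b (J x c a * J x d b) *: dmx a (Gam H b) (phi x).
  rewrite /pullGam (@dmx_sum _ _ c _ _ _ _ _ _ 0 U) //; last first.
    by move=> a _; apply: cmxZ => //; exact: cmx_pullback.
  rewrite exchange_big/= -big_split/=; apply: eq_bigr => b _.
  rewrite (dmxZ c (cJ d b) (cmx_pullback (cgH 0 b)) Ux) -dmxE dmx_pullback//.
  rewrite scaler_sumr; congr (_ + _); apply: eq_bigr => a _.
  by rewrite scalerA mulrC.
have mA c d : pullGam d x *m pullGam c x =
   \sum_a \sum_b (J x c a * J x d b) *: (Gam H b (phi x) *m Gam H a (phi x)).
  rewrite /pullGam mulmx_suml exchange_big/=; apply: eq_bigr => b _.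
  rewrite mulmx_sumr; apply: eq_bigr => a _.
  by rewrite -scalemxAl -scalemxAr scalerA mulrC.
have sw c d (F : 'I_n -> 'I_n -> 'M[R]_n) :
    \sum_a \sum_b (J x c a * J x d b) *: F a b =
    \sum_a \sum_b (J x d a * J x c b) *: F b a.
  rewrite exchange_big/=; apply: eq_bigr => a _; apply: eq_bigr => b _.
  by rewrite mulrC.
rewrite !dA !mA (sw j i) (sw j i (fun a b => Gam H b (phi x) *m Gam H a (phi x))).
have -> : \sum_a dmx j J x i a *: Gam H a (phi x) =
    \sum_a dmx i J x j a *: Gam H a (phi x).
  by apply: eq_bigr => a _; rewrite dmx_jac.
have cancel (P Q Q' : 'M[R]_n) : P + Q - (P + Q') = Q - Q'.
  by rewrite opprD addrACA subrr add0r.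
rewrite cancel /pullCurv -!sumrB -big_split/=.
apply: eq_bigr => a _; rewrite -!sumrB -big_split/=; apply: eq_bigr => b _.
by rewrite CurvE scalerDr !scalerBr.
Qed.

(** Differentiate the law of [Gam_change] once more and antisymmetrise in i, j; the second
    derivatives of J drop out. *)
Lemma Curv_change i j x : U x -> Curv G i j x *m J x = J x *m pullCurv i j x.
Proof.
move=> Ux; rewrite CurvE pullCurvE//.
have cJ k := cmx_jac k; have cA k a := cmx_pullGam k a.
have cg k a : cmx k U (Gam G a) by exact: cmx_Gam.
have dE c d : dmx c (Gam G d) x *m J x + Gam G d x *m dmx c J x =
    dmx c (dmx d J) x + (dmx c J x *m pullGam d x + J x *m dmx c (pullGam d) x).
  rewrite -(dmxM c (cg 0 d) (cJ 0) Ux) (dmx_eq c oU (@Gam_change d) Ux).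
  rewrite (dmxD c (cmx_dmx d oU (cJ 1)) (cmxM oU (cJ 0) (cA 0 d)) Ux).
  by rewrite (dmxM c (cJ 0) (cA 0 d) Ux).
have mE c d : Gam G c x *m Gam G d x *m J x =
    Gam G c x *m dmx d J x + dmx c J x *m pullGam d x
    + J x *m (pullGam c x *m pullGam d x).
  by rewrite -mulmxA Gam_change// mulmxDr mulmxA Gam_change// mulmxDl !mulmxA addrA.
have ddJ := dmxC i j oU (cJ 2) Ux.
have Eij := dE i j; have Eji := dE j i; rewrite ddJ in Eij.
rewrite !(mulmxDl, mulmxDr, mulNmx, mulmxN) !mE.
apply/matrixP => a b; move/matrixP/(_ a b): Eij; move/matrixP/(_ a b): Eji.
by rewrite !linmxE; lra.
Qed.

(** The contracted index carries one J and one inverse of J, which cancel by [C]; a factor J remains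
    for each free index. *)
Lemma ricci_change x : U x ->
  local_ricci G x = J x *m local_ricci H (phi x) *m (J x)^T.
Proof.
move=> Ux; apply/matrixP => j k; rewrite ricciE.
have uJ := jac_unit Ux.
have C a b : \sum_i (J x *m Curv H a b (phi x) *m invmx (J x)) k i * J x i a =
   \sum_c J x k c * Curv H a b (phi x) c a.
  by rewrite -mulmx_sumE mulmxKV// mulmx_sumE.
have E i : Curv G i j x k i = \sum_a \sum_b J x j b *
    ((J x *m Curv H a b (phi x) *m invmx (J x)) k i * J x i a).
  rewrite -[Curv G i j x](mulmxK uJ) Curv_change// /pullCurv.
  rewrite mulmx_sumr mulmx_suml summxE; apply: eq_bigr => a _.
  rewrite mulmx_sumr mulmx_suml summxE; apply: eq_bigr => b _.
  rewrite -scalemxAr -scalemxAl scalemxE; ring.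
under eq_bigr do rewrite E.
rewrite exchange_big/= mulmx_sumE.
under eq_bigr do rewrite exchange_big/=.
under eq_bigr do under eq_bigr do rewrite -mulr_sumr C.
under [RHS]eq_bigr do rewrite trmxE mulmx_sumE mulr_suml.
rewrite exchange_big/= [RHS]exchange_big/=; apply: eq_bigr => b _.
rewrite -mulr_sumr exchange_big/= mulr_sumr; apply: eq_bigr => c _.
by rewrite -mulr_sumr -ricciE mulrCA mulrC.
Qed.

Lemma scal_change x : U x -> local_scal G x = local_scal H (phi x).
Proof.
move=> Ux; have uJ := jac_unit Ux; have uJT : (J x)^T \in unitmx by rewrite unitmx_tr.
have uHx := uH (UV Ux).
rewrite !scalE ricci_change//.
have -> : invmx (G x) = invmx (J x)^T *m invmx (H (phi x)) *m invmx (J x).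
  rewrite -[RHS]mul1mx -(mulVmx (uG Ux)) -[LHS]mulmx1 -!mulmxA; congr (_ *m _).
  by rewrite GH// -!mulmxA !(mulKVmx, mulmxV).
rewrite !trmx_mul trmxK -!mulmxA (mulKmx uJ) mxtrace_mulC -!mulmxA.
by rewrite mulmxV// mulmx1.
Qed.

End change_of_coordinates.

(** * Positive definite matrices *)

Section positive_matrices.
Context (R : realType).

Lemma posdef_unit (n : nat) (A : 'M[R]_n) : posdef A -> A \in unitmx.
Proof.
move=> pA; rewrite unitmxE unitfE; apply/negP => /det0P[v v0 vA].
by have := pA v v0; rewrite vA mul0mx mxE ltxx.
Qed.

Lemma posdef_inv (n : nat) (A : 'M[R]_n) : A^T = A -> posdef A -> posdef (invmx A).
Proof.
move=> sA pA v v0; have uA := posdef_unit pA.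
have := pA (v *m invmx A); rewrite trmx_mul trmx_inv sA mulmxA mulmxKV//.
by apply; apply: contra_neq v0 => v0; rewrite -[v](mulmxKV uA) v0 mul0mx.
Qed.

(** Elimination of the first row and column: the Schur complement of the corner a is again positive
    definite. *)
Lemma cholesky (n : nat) (A : 'M[R]_n) : A^T = A -> posdef A ->
  exists Q : 'M[R]_n, A = Q *m Q^T.
Proof.
elim: n A => [|n IH] A sA pA.
  by exists 0; apply/matrixP => -[].
move: A sA pA; rewrite -[n.+1]/(1 + n)%N => A sA pA.
pose a : R := ulsubmx A 0 0; pose b : 'rV[R]_n := ursubmx A.
pose D : 'M[R]_n := drsubmx A.
have eA : A = block_mx a%:M b b^T D.
  rewrite -[LHS]submxK; congr block_mx.
    by rewrite [LHS]mx11_scalar.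
  by rewrite /b -[in RHS]sA trmx_ursub trmxK.
have sD : D^T = D by rewrite /D trmx_drsub sA.
have a0 : 0 < a.
  have := pA (row_mx 1 0); rewrite eA mul_row_block tr_row_mx mul_row_col.
  rewrite !trmx0 !mulmx0 !mul0mx !addr0 trmx1 mulmx1 mul1mx mxE eqxx mulr1n; apply.
  by apply/eqP => /(congr1 lsubmx); rewrite row_mxKl linear0 => /matrixP/(_ 0 0)/eqP;
    rewrite !mxE oner_eq0.
have sE : (D - a^-1 *: (b^T *m b))^T = D - a^-1 *: (b^T *m b).
  by rewrite linearB/= linearZ/= trmx_mul trmxK sD.
have pE : posdef (D - a^-1 *: (b^T *m b)).
  (* For given v, this first coordinate minimises the form of A; the minimum is the Schur complement
     at v. *)
  move=> v v0; have := pA (row_mx (- a^-1 *: (v *m b^T)) v).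
  have nz : row_mx (- a^-1 *: (v *m b^T)) v != 0.
    by apply: contra_neq v0 => /(congr1 rsubmx); rewrite row_mxKr linear0.
  move=> /(_ nz); rewrite eA mul_row_block tr_row_mx mul_row_col mul_mx_scalar.
  have -> : a *: (- a^-1 *: (v *m b^T)) + v *m b^T = 0.
    by rewrite scalerA mulrN divff ?gt_eqF// scaleN1r addNr.
  rewrite mul0mx add0r mulmxBr -scalemxAl -mulmxA scaleNr -scalemxAr.
  by rewrite mulmxA addrC.
have [Q eQ] := IH _ sE pE.
have s0 : Num.sqrt a != 0 by rewrite sqrtr_eq0 -ltNge.
exists (block_mx (Num.sqrt a)%:M 0 ((Num.sqrt a)^-1 *: b^T) Q).
rewrite tr_block_mx mulmx_block !trmx0 !mulmx0 !mul0mx !addr0 tr_scalar_mx.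
rewrite linearZ/= trmxK -eQ eA; congr block_mx.
- by rewrite -scalar_mxM -expr2 sqr_sqrtr// ltW.
- by rewrite mul_scalar_mx scalerA divff// scale1r.
- by rewrite mul_mx_scalar scalerA divff// scale1r.
- rewrite -scalemxAl -scalemxAr scalerA -invfM -expr2 sqr_sqrtr ?ltW//.
  by rewrite addrC subrK.
Qed.

Lemma psd_trace0 (n : nat) (A E : 'M[R]_n) : A^T = A -> posdef A ->
  E^T = E -> (forall v : 'rV_n, 0 <= (v *m E *m v^T) 0 0) ->
  \tr (A *m E) = 0 -> E = 0.
Proof.
move=> sA pA sE pE; have [Q eQ] := cholesky sA pA.
have uQ : Q \in unitmx.
  by have := posdef_unit pA; rewrite eQ unitmx_mul => /andP[].
have uQT : Q^T \in unitmx by rewrite unitmx_tr.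
set F := Q^T *m E *m Q.
have sF : F^T = F by rewrite /F !trmx_mul trmxK sE mulmxA.
have pF (v : 'rV_n) : 0 <= (v *m F *m v^T) 0 0.
  by have := pE (v *m Q^T); rewrite trmx_mul trmxK !mulmxA.
pose e i : 'rV[R]_n := delta_mx 0 i.
have Fij i j : F i j = (e i *m F *m (e j)^T) 0 0.
  by rewrite /e -rowE trmx_delta -colE !mxE.
have F0 i : 0 <= F i i by rewrite Fij.
rewrite eQ -mulmxA mxtrace_mulC -/F => trF.
have Fii i : F i i = 0 by apply: (psumr_eq0P _ trF).
have Fs i j : F j i = F i j by rewrite -[in LHS]sF mxE.
(* Since the diagonal vanishes, the form at e_i + t e_j is 2 t F_ij; both signs of t force F_ij =
   0. *)
have FE i j (t : R) : t = 1 \/ t = -1 -> 0 <= t * F i j.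
  move=> t1; have := pF (e i + t *: e j).
  rewrite linearD linearZ/= !(mulmxDl, mulmxDr) -!scalemxAl -!scalemxAr.
  rewrite !linmxE -!Fij !Fii Fs.
  by case: t1 => ->; lra.
have {}F0 : F = 0.
  apply/matrixP => i j; rewrite [RHS]mxE; apply/eqP; rewrite eq_le.
  have := FE i j 1 (or_introl erefl); have := FE i j (-1) (or_intror erefl).
  by rewrite mul1r mulN1r oppr_ge0 => -> ->.
have : invmx Q^T *m F *m invmx Q = E by rewrite /F !mulmxA mulVmx// mul1mx mulmxK.
by rewrite F0 mulmx0 mul0mx.
Qed.

End positive_matrices.

(** * Einstein metrics on a manifold *)

Lemma open_preimage_within (T T' : topologicalType) (A : set T)
    (B : set T') (f : T -> T') :
  open A -> {within A, continuous f} -> open B -> open (A `&` f @^-1` B).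
Proof.
move=> oA; rewrite continuous_open_subspace// => cf oB; rewrite openE => x [Ax Bfx].
apply: filterI; first exact: open_nbhs_nbhs.
by apply: cf; [rewrite inE|exact: open_nbhs_nbhs].
Qed.

Section manifold.
Context (R : realType) (n : nat) (M : smoothManifold R n) (g : riemannianMetric M).
Implicit Types (c d : chart R n M) (p q : M) (x : 'rV[R]_n).

Lemma chart_imgP c p : chart_dom c p -> chart_img c (c p).
Proof. by move=> cp; exists p. Qed.

Lemma overlapE c d :
  overlap c d = chart_img c `&` chart_inv c @^-1` chart_dom d.
Proof.
apply/seteqP; split=> [x [p [cp dp] <-]|x [[p cp <-]]] /=.
  by split; [exact: chart_imgP|rewrite /= chart_mapK].
by rewrite chart_mapK// => dp; exists p.
Qed.

Lemma overlap_open c d : open (overlap c d).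
Proof.
rewrite overlapE; apply: open_preimage_within.
- exact: chart_img_open.
- exact: chart_inv_continuous.
- exact: chart_dom_open.
Qed.

Lemma overlap_sub c d : overlap c d `<=` chart_img c.
Proof. by rewrite overlapE => x []. Qed.

Lemma transition_img c d x : overlap c d x -> chart_img d (transition c d x).
Proof.
move=> [p [cp dp] <-]; rewrite /transition/= chart_mapK//; exact: chart_imgP.
Qed.

Lemma cmx_metric k c : atlas c -> cmx k (chart_img c) (g c).
Proof.
by move=> ac; apply: ck_coord; [exact: chart_img_open|exact: metric_smooth].
Qed.

Lemma metric_unit c x : atlas c -> chart_img c x -> g c x \in unitmx.
Proof. by move=> ac cx; apply/posdef_unit/metric_posdef. Qed.

Lemma Scal_chart c d p : atlas c -> atlas d -> chart_dom c p -> chart_dom d p ->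
  Scal g c (c p) = Scal g d (d p).
Proof.
move=> ac ad cp dp; have op : overlap c d (c p) by exists p.
have sT := atlas_smooth ac ad.
have dT x : overlap c d x -> differentiable (transition c d) x.
  by move=> ox; exact: (sT [::] x ox).
have -> : d p = transition c d (c p) by rewrite /transition/= chart_mapK.
apply: (@scal_change _ _ (overlap c d) (chart_img d) _ (g c) (g d)) => //.
- exact: overlap_open.
- exact: chart_img_open.
- by move=> x; exact: transition_img.
- by move=> k a; apply: ck_coord sT _ _; exact: overlap_open.
- by move=> k i j; apply: (ck_sub (@overlap_sub c d)); exact: cmx_metric.
- by move=> x /overlap_sub cx; exact: (Defs.metric_sym g ac cx).
- by move=> x /overlap_sub cx; exact: (metric_unit ac cx).
- by move=> k; exact: cmx_metric.
- by move=> x cx; exact: Defs.metric_sym.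
- by move=> x cx; exact: metric_unit.
- by move=> x ox; rewrite -jacobianE; [exact: metric_transition|exact: dT].
Qed.

Lemma Ein_dim_ricci : (0 < n)%N -> Ein g = n%:R ->
  Scal_pos g /\ forall c x, atlas c -> chart_img c x ->
    Ric g c x = (Scal g c x / n%:R) *: g c x.
Proof.
move=> n0; have n0R : n%:R != 0 :> R by rewrite pnatr_eq0 -lt0n.
rewrite /Ein; case: asboolP => [Sp|_ /esym/eqP]; last by rewrite (negPf n0R).
set S := [set k | _] => supS; split => // c x ac cx.
have hsS : has_sup S.
  split; last by exists n%:R => k [/andP[_ /ltW]].
  (* The supremum of the empty set is 0 by convention, which differs from n, so some k is
     admissible. *)
  apply/set0P/eqP => S0; move: supS; rewrite S0 sup0 => /esym/eqP.
  by rewrite (negPf n0R).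
have sG : (g c x)^T = g c x by exact: Defs.metric_sym.
have uG : g c x \in unitmx by exact: metric_unit.
have pG : posdef (g c x) by exact: metric_posdef.
have sRic : (Ric g c x)^T = Ric g c x.
  apply: (@ricci_sym _ _ (chart_img c) (g c)) => //.
  - exact: chart_img_open.
  - by move=> k; exact: cmx_metric.
  - by move=> y; exact: Defs.metric_sym.
  - by move=> y; exact: metric_unit.
have psd (v : 'rV_n) : 0 <= (v *m Ein_ n%:R g c x *m v^T) 0 0.
  have [->|v0] := eqVneq v 0; first by rewrite !mul0mx mxE.
  have E k : (v *m Ein_ k g c x *m v^T) 0 0 = Scal g c x * (v *m g c x *m v^T) 0 0
      - k * (v *m Ric g c x *m v^T) 0 0.
    rewrite /Ein_ mulmxBr mulmxBl -!scalemxAr -!scalemxAl.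
    by rewrite addmxE oppmxE !scalemxE.
  have sq : 0 < Scal g c x * (v *m g c x *m v^T) 0 0.
    by rewrite mulr_gt0//; [exact: Sp|exact: pG].
  rewrite E leNgt; apply/negP => neg.
  set s := Scal g c x * _ in E sq neg; set r := (v *m Ric g c x *m v^T) 0 0 in E neg.
  have r0 : 0 < r.
    by rewrite -(@pmulr_rgt0 _ n%:R) ?ltr0n//; lra.
  (* This is the gap n - s / r. An admissible k within it of the supremum n exceeds s / r, whereas
     positivity of [Ein_ k] at v says k r < s. *)
  have e0 : 0 < (n%:R * r - s) / r by rewrite divr_gt0//; lra.
  have [k [kn Ek] nk] := sup_adherent e0 hsS.
  have := Ek c x ac cx v v0; rewrite E -/s -/r => skr.
  move: nk; rewrite supS -(ltr_pM2r r0) mulrBl divfK ?gt_eqF//; lra.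
have tr0 : \tr (invmx (g c x) *m Ein_ n%:R g c x) = 0.
  have E : \tr (invmx (g c x) *m Ric g c x) = Scal g c x by rewrite -sRic [RHS]scalE.
  rewrite /Ein_ mulmxBr -!scalemxAr linearB/= !mxtraceZ mulVmx// mxtrace1 E.
  by rewrite mulrC subrr.
have sE : (Ein_ n%:R g c x)^T = Ein_ n%:R g c x.
  by rewrite /Ein_ linearB/= !linearZ/= sG sRic.
have sI : (invmx (g c x))^T = invmx (g c x) by rewrite trmx_inv sG.
have /eqP := psd_trace0 sI (posdef_inv sG pG) sE psd tr0.
rewrite subr_eq0 => /eqP E.
by rewrite mulrC -scalerA E scalerA mulVf// scale1r.
Qed.

(** Schur's lemma gives zero partial derivatives in the chart, hence constancy on a coordinate ball;
    W is that ball pulled back to M. *)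
Lemma einstein_locally_constant : (0 < n)%N -> (n != 2)%N ->
  (forall c x, atlas c -> chart_img c x -> Ric g c x = (Scal g c x / n%:R) *: g c x) ->
  forall c p, atlas c -> chart_dom c p ->
  exists2 W, open W /\ W p &
    W `<=` chart_dom c `&` [set q | Scal g c (c q) = Scal g c (c p)].
Proof.
move=> n0 n2 ein c p ac cp.
have oU : open (chart_img c) := @chart_img_open _ _ _ c.
have cG k : cmx k (chart_img c) (g c) by exact: cmx_metric.
have uG x : chart_img c x -> g c x \in unitmx by exact: metric_unit.
have cS k : ck k (chart_img c) (Scal g c) by exact: ck_scal.
have cL k : ck k (chart_img c) (fun x => Scal g c x / n%:R).
  by apply: ckM => //; exact: ck_cst.
have dL i x : chart_img c x -> partial i (fun x => Scal g c x / n%:R) x = 0.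
  move=> cx.
  have sG y : chart_img c y -> (g c y)^T = g c y.
    by move=> cy; exact: (Defs.metric_sym g ac cy).
  have einc y : chart_img c y -> local_ricci (g c) y = (Scal g c y / n%:R) *: g c y.
    by move=> cy; exact: ein.
  have /eqP := schur_derivative oU cG sG uG (cL 0) einc i cx.
  by rewrite mulf_eq0 subr_eq0 (eqr_nat R n 2) (negPf n2) => /eqP.
have /nbhs_ballP[e /= e0 be] : nbhs (c p) (chart_img c).
  by apply: open_nbhs_nbhs; split=> //; exact: chart_imgP.
have cst y : ball (c p) e y -> Scal g c y / n%:R = Scal g c (c p) / n%:R.
  apply: (@partial0_ball _ _ (fun x => Scal g c x / n%:R)) => [z|i z] /be cz.
    exact: ck_diff (cL 0) cz.
  exact: dL.
exists (chart_dom c `&` c @^-1` ball (c p) e).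
  split; last by split=> //; exact: ballxx.
  apply: open_preimage_within; last exact: ball_open.
  - exact: chart_dom_open.
  - exact: chart_map_continuous.
have ninv : (n%:R : R)^-1 != 0 by rewrite invr_eq0 pnatr_eq0 -lt0n.
by move=> q [cq bq]; split; [exact: cq|exact: (mulIf ninv (cst _ bq))].
Qed.

Lemma Ein_dim_einstein : (0 < n)%N -> Ein g = n%:R -> Einstein g /\ Scal_pos g.
Proof.
move=> n0 /(Ein_dim_ricci n0)[Sp ein]; split=> //.
(* A chart is chosen at each point, and [Scal_chart] makes the value independent of the choice. *)
have [lam lamE] : exists lam : M -> R, forall c p, atlas c -> chart_dom c p ->
    lam p = Scal g c (c p) / n%:R.
  have ch p : {c | atlas c & chart_dom c p} by apply: cid2; exact: atlas_cover.
  exists (fun p => Scal g (s2val (ch p)) (s2val (ch p) p) / n%:R) => c p ac cp.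
  by rewrite (Scal_chart (s2valP (ch p)) ac (s2valP' (ch p)) cp).
exists lam; split=> [c p ac cp|n2 p q pq].
  by rewrite (lamE c)// ein//; exact: chart_imgP.
(* Stated for any P so as to apply to a level set and to its complement: level sets of [lam] are
   open and closed, and one that meets a connected component contains it. *)
have open_level (P : R -> Prop) : open [set z | P (lam z)].
  rewrite openE => z /= Pz; have [c ac cz] := atlas_cover z.
  have [W [oW Wz] WW] := einstein_locally_constant n0 n2 ein ac cz.
  apply: filterS (open_nbhs_nbhs (conj oW Wz)) => y /WW[cy Ey].
  have E : lam y = lam z by rewrite (lamE c y ac cy) Ey (lamE c z ac cz).
  by rewrite /= E.
pose C := connected_component [set: M] p.
have Cp : C p by exact: connected_component_refl.
have : C `&` [set z | lam z = lam p] = C.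
  apply: (@component_connected _ [set: M] p).
  - by exists p.
  - by exists [set z | lam z = lam p] => //; exact: (open_level (fun a => a = lam p)).
  - exists [set z | lam z = lam p] => //.
    rewrite -[X in closed X]setCK; apply: open_closedC.
    exact: (open_level (fun a => ~ (a = lam p))).
by move=> /seteqP[_ /(_ q pq)[_ /= ->]].
Qed.

Lemma einstein_Ein_dim : (0 < n)%N -> Einstein g -> Scal_pos g -> Ein g = n%:R.
Proof.
move=> n0 [lam [ein _]] Sp; rewrite /Ein; case: asboolP => // _.
have n0R : 0 < n%:R :> R by rewrite ltr0n.
have Epos k : 0 < k < n%:R -> Ein_pos k g.
  move=> /andP[k0 kn] c _ ac [p cp <-] v v0; have cx := chart_imgP cp.
  have uG := metric_unit ac cx.
  have eS : Scal g c (c p) = n%:R * lam p.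
    rewrite /Scal scalE -/(Ric g c (c p)) ein// linearZ/= (Defs.metric_sym g ac cx).
    by rewrite -scalemxAr mxtraceZ mulVmx// mxtrace1 mulrC.
  have l0 : 0 < lam p by rewrite -(pmulr_rgt0 _ n0R) -eS; exact: Sp.
  have -> : Ein_ k g c (c p) = ((n%:R - k) * lam p) *: g c (c p).
    by rewrite /Ein_ eS ein// scalerA -scalerBl mulrBl.
  rewrite -scalemxAr -scalemxAl scalemxE mulr_gt0//.
    by rewrite mulr_gt0// subr_gt0.
  exact: metric_posdef.
(* The admissible k fill the whole open interval, nonempty as n > 0, so the supremum is its right
   end. *)
have -> : [set k : R | 0 < k < n%:R /\ Ein_pos k g] = `]0, n%:R[%classic.
  apply/seteqP; split=> k /=; rewrite in_itv/=; first by case.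
  by move=> kn; split=> //; exact: Epos.
by rewrite sup_itv.
Qed.

End manifold.

Theorem proposition1p2 (R : realType) (n : nat) (hn : (0 < n)%N)
    (M : smoothManifold R n) (hM : compact [set: M])
    (g : riemannianMetric M) :
  Ein g = n%:R <-> Einstein g /\ Scal_pos g.
Proof.
split; first exact: Ein_dim_einstein.
by move=> [eg Sg]; exact: einstein_Ein_dim.
Qed.
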